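(* Let $\Gamma=\{(t,e^{t^2}):t\in\mathbb R\}\subset\mathbb R^2$. (i) Let $\Lambda\subset\mathbb R^2$ be a straight line. Then $(\Gamma,\Lambda)$ is a Heisenberg uniqueness pair if and only if $\Lambda$ is parallel to the $x$-axis. (ii) Let $L_1,L_2\subset\mathbb R^2$ be two (distinct) parallel lines which are not parallel to either of the coordinate axes. Then $(\Gamma,L_1\cup L_2)$ is a Heisenberg uniqueness pair.
   Context: For a smooth curve $\Gamma\subset\mathbb R^2$, $X(\Gamma)$ denotes the space of all finite complex-valued Borel measures $\mu$ on $\mathbb R^2$ which are supported on $\Gamma$ and absolutely continuous with respect to the arc length measure on $\Gamma$. The Fourier transform of $\mu\in X(\Gamma)$ is $\hat\mu(x,y)=\int_\Gamma e^{-i\pi(sx+ty)}\,d\mu(s,t)$, $(x,y)\in\mathbb R^2$. For $\Lambda\subset\mathbb R^2$, the pair $(\Gamma,\Lambda)$ is a Heisenberg uniqueness pair (HUP) if the only $\mu\in X(\Gamma)$ with $\hat\mu|_\Lambda=0$ is $\mu=0$. ''Parallel to the $x$-axis'' includes the $x$-axis itself. *)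

(* Defs.v *)
From HB Require Import structures.
From mathcomp Require Import all_boot all_order all_algebra.
From mathcomp Require Import all_classical all_reals all_analysis.
From mathcomp Require Import complex.

Set Implicit Arguments.
Unset Strict Implicit.
Unset Printing Implicit Defensive.

Import Order.TTheory GRing.Theory Num.Theory.
Import numFieldNormedType.Exports.

Local Open Scope classical_set_scope.
Local Open Scope ring_scope.
Local Open Scope complex_scope.

(* Its product sigma-algebra is the Borel sigma-algebra of R^2. *)
Definition plane (R : realType) := (measurableTypeR R * measurableTypeR R)%type.

(* A charge has finite values on measurable sets, hence [mre +i* mim] is a
   finite complex measure, and every such measure is of this form.  Values on
   non-measurable sets are junk. *)
Record complex_measure (d : measure_display) (T : measurableType d)
    (R : realType) := ComplexMeasure {
  mre : {charge set T -> \bar R} ;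
  mim : {charge set T -> \bar R} }.

Definition cmeasure (d : measure_display) (T : measurableType d)
    (R : realType) (mu : complex_measure T R) (A : set T) : R[i] :=
  fine (mre mu A) +i* fine (mim mu A).

Definition hahn_pos (d : measure_display) (T : measurableType d)
    (R : realType) (nu : {charge set T -> \bar R}) : set T :=
  projT1 (cid (Hahn_decomposition nu)).

Definition hahn_neg (d : measure_display) (T : measurableType d)
    (R : realType) (nu : {charge set T -> \bar R}) : set T :=
  projT1 (cid (projT2 (cid (Hahn_decomposition nu)))).

Lemma hahn_pos_neg (d : measure_display) (T : measurableType d)
    (R : realType) (nu : {charge set T -> \bar R}) :
  hahn_decomposition nu (hahn_pos nu) (hahn_neg nu).
Proof. exact: (projT2 (cid (projT2 (cid (Hahn_decomposition nu))))). Qed.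

(* The Jordan parts do not depend on the choice of the Hahn decomposition, see
   [Hahn_decomposition_uniq]. *)
Definition charge_integral (d : measure_display) (T : measurableType d)
    (R : realType) (nu : {charge set T -> \bar R}) (f : T -> R) : R :=
  Rintegral (jordan_pos (hahn_pos_neg nu)) setT f -
  Rintegral (jordan_neg (hahn_pos_neg nu)) setT f.

Definition cintegral (d : measure_display) (T : measurableType d)
    (R : realType) (mu : complex_measure T R) (f : T -> R[i]) : R[i] :=
  (charge_integral (mre mu) (fun p => complex.Re (f p)) -
   charge_integral (mim mu) (fun p => complex.Im (f p))) +i*
  (charge_integral (mre mu) (fun p => complex.Im (f p)) +
   charge_integral (mim mu) (fun p => complex.Re (f p))).

(* e^(i theta) *)
Definition expi (R : realType) (theta : R) : R[i] := cos theta +i* sin theta.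

Definition fourier (R : realType) (mu : complex_measure (plane R) R)
    (xi : R * R) : R[i] :=
  cintegral mu (fun p : plane R => expi (- (pi * (p.1 * xi.1 + p.2 * xi.2)))).

(* Curves are given by a parametrization [gamma] defined on the whole line,
   meant to be smooth and injective; the curve itself is [range gamma]. *)
Definition speed (R : realType) (gamma : R -> R * R) (t : R) : R :=
  Num.sqrt (derive1 (fun s => (gamma s).1) t ^+ 2 +
            derive1 (fun s => (gamma s).2) t ^+ 2).

Definition arc_length (R : realType) (gamma : R -> R * R)
    (A : set (R * R)) : \bar R :=
  (\int[@lebesgue_measure R]_(t in gamma @^-1` A) (speed gamma t)%:E)%E.

Definition supported_on (R : realType) (mu : complex_measure (plane R) R)
    (S : set (R * R)) : Prop :=
  forall A : set (plane R), measurable A -> A `&` S = set0 ->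
    cmeasure mu A = 0.

(* The space X(Gamma), for Gamma = range gamma. *)
Definition X (R : realType) (gamma : R -> R * R) :
    set (complex_measure (plane R) R) :=
  [set mu | supported_on mu (range gamma) /\
    forall A : set (plane R), measurable A -> arc_length gamma A = 0%E ->
      cmeasure mu A = 0].

Definition heisenberg_uniqueness_pair (R : realType) (gamma : R -> R * R)
    (Lambda : set (R * R)) : Prop :=
  forall mu : complex_measure (plane R) R, X gamma mu ->
    (forall xi, Lambda xi -> fourier mu xi = 0) ->
    forall A : set (plane R), measurable A -> cmeasure mu A = 0.

Definition line (R : realType) (p v : R * R) : set (R * R) :=
  [set q | exists s : R, q = (p.1 + s * v.1, p.2 + s * v.2)].

Definition straight_line (R : realType) (L : set (R * R)) : Prop :=
  exists p v : R * R, v <> (0, 0) /\ L = line p v.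

(* A line is parallel to itself. *)
Definition parallel (R : realType) (L M : set (R * R)) : Prop :=
  exists p q v : R * R, [/\ v <> (0, 0), L = line p v & M = line q v].

Definition x_axis (R : realType) : set (R * R) := [set q | q.2 = 0].
Definition y_axis (R : realType) : set (R * R) := [set q | q.1 = 0].

Definition exp_sq_curve (R : realType) (t : R) : R * R := (t, expR (t ^+ 2)).

(* Main.v *)
(** A measure in X(Gamma) is the image under t |-> (t, e^(t^2)) of f dt with f
    integrable.  On a line with base point p and direction v, its Fourier
    transform is that of the image of f e^(-i w) dt under
    Y(t) = v.1 t + v.2 e^(t^2), where w(t) = pi (p.1 t + p.2 e^(t^2)).  By
    uniqueness of Fourier transforms, it vanishes on the line iff
    f e^(-i w) dt integrates every bounded Borel function of Y to 0.

    If v is horizontal, Y is injective and f = 0.  Otherwise one may take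
    v = (c, 1); then Y is strictly convex, takes the same value at the ends of
    some interval J, and f = e^(i w) Y' 1_J is a counterexample because the
    integral of k(Y) Y' over J is 0.

    For two such lines, based at (a1, 0) and (a2, 0), put F = f e^(-i w1) and
    let t' be the other solution of Y(t') = Y(t).  The two conditions are a
    linear system for the contributions of F at t and t', and its determinant
    e^(-i b t) - e^(-i b t'), with b = pi (a2 - a1), vanishes only for
    countably many t; hence F = 0 almost everywhere. *)
Require Import Defs.
From mathcomp Require Import all_boot all_order all_algebra.
From mathcomp Require Import all_classical all_reals all_analysis.
From mathcomp Require Import measurable_realfun complex ring lra.

Set Implicit Arguments.
Unset Strict Implicit.
Unset Printing Implicit Defensive.

Import Order.TTheory GRing.Theory Num.Theory.
Import numFieldNormedType.Exports.

Local Open Scope classical_set_scope.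
Local Open Scope ring_scope.

(** * Bounded measurable functions and a monotone class principle *)

Definition bounded_measurable d (T : measurableType d) (R : realType)
    (h : T -> R) : Prop :=
  measurable_fun setT h /\ exists K : R, forall x, `|h x| <= K.

Section bounded_measurable.
Import HBNNSimple.

Context d (T : measurableType d) (R : realType).
Implicit Types h k : T -> R.

Lemma bounded_measurableM h k : bounded_measurable h -> bounded_measurable k ->
  bounded_measurable (fun x => h x * k x).
Proof.
move=> [mh [K hK]] [mk [K' kK']]; split; first exact: measurable_funM.
by exists (K * K') => x; rewrite normrM ler_pM.
Qed.

Lemma bounded_measurableD h k : bounded_measurable h -> bounded_measurable k ->
  bounded_measurable (fun x => h x + k x).
Proof.
move=> [mh [K hK]] [mk [K' kK']]; split; first exact: measurable_funD.
by exists (K + K') => x; rewrite (le_trans (ler_normD _ _))// lerD.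
Qed.

Lemma bounded_measurable_cst c : bounded_measurable (cst c : T -> R).
Proof. by split => //; exists `|c|. Qed.

Lemma bounded_measurable_indic (A : set T) : measurable A ->
  bounded_measurable (\1_A : T -> R).
Proof.
move=> mA; split; first exact: measurable_indic.
by exists 1 => x; rewrite indicE normr_nat lern1 leq_b1.
Qed.

Lemma bounded_measurable_cos (Y : T -> R) : measurable_fun setT Y ->
  bounded_measurable (fun x => cos (Y x)).
Proof.
move=> mY; split; last by exists 1 => x; exact: cos_max.
exact: (measurableT_comp (continuous_measurable_fun (@continuous_cos R))).
Qed.

Lemma bounded_measurable_sin (Y : T -> R) : measurable_fun setT Y ->
  bounded_measurable (fun x => sin (Y x)).
Proof.
move=> mY; split; last by exists 1 => x; exact: sin_max.
exact: (measurableT_comp (continuous_measurable_fun (@continuous_sin R))).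
Qed.

Lemma bounded_measurable_cvg (h_ : nat -> T -> R) h (K : R) :
  (forall n, measurable_fun setT (h_ n)) -> (forall n x, `|h_ n x| <= K) ->
  (forall x, h_ n x @[n --> \oo] --> h x) -> bounded_measurable h.
Proof.
move=> mh_ h_K hh; split.
  by apply: (measurable_fun_cvg (h := h_)) => // x _; exact: hh.
exists K => x; apply: (cvgr_to_le (cvg_norm (hh x))).
by apply: nearW => n; exact: h_K.
Qed.

(** Adding [K] makes the function nonnegative, hence a limit of simple functions that stay below
    [h + K]. These are finite linear combinations of indicators, and subtracting [K] returns to
    [h]. *)
Lemma bounded_measurable_ind (P : (T -> R) -> Prop) :
  (forall A, measurable A -> P \1_A) ->
  (forall h k, P h -> P k -> P (fun x => h x + k x)) ->
  (forall c h, P h -> P (fun x => c * h x)) ->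
  (forall (h_ : nat -> T -> R) h (K : R), (forall n, P (h_ n)) -> (forall n x, `|h_ n x| <= K) ->
    (forall x, h_ n x @[n --> \oo] --> h x) -> P h) ->
  forall h, bounded_measurable h -> P h.
Proof.
move=> P1 PD PM Pl h [mh [K hK]].
have P0 : P (fun=> 0).
  have := PM 0 _ (P1 setT measurableT); congr P.
  by apply/funext => x; rewrite mul0r.
have PK c : P (cst c).
  have := PM c _ (P1 setT measurableT); congr P.
  by apply/funext => x; rewrite indicT mulr1.
have mhK : measurable_fun setT (EFin \o (fun x => h x + K)).
  by apply/measurable_EFinP; exact: measurable_funD.
have hK0 x : setT x -> (0 <= (EFin \o (fun x => h x + K)%R) x)%E.
  by move=> _; rewrite lee_fin -lerBlDr sub0r; case/ler_normlP: (hK x); rewrite lerNl.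
pose g n : T -> R := nnsfun_approx measurableT mhK n.
have gle n x : 0 <= g n x <= h x + K.
  apply/andP; split; first exact: fun_ge0.
  by rewrite -lee_fin /g nnsfun_approxE; exact: le_approx.
have gcvg x : g n x @[n --> \oo] --> h x + K.
  have /fine_cvgP[] := (cvg_nnsfun_approx measurableT mhK hK0 (x := x) I) => _; exact.
have Pg n : P (g n).
  have [s ->] : exists s : seq R, g n = fun x =>
      \sum_(y <- s) y * \1_(nnsfun_approx measurableT mhK n @^-1` [set y]) x.
    by eexists; apply/funext => x; rewrite /g fimfunE fsbig_finite.
  elim: s => [|y s IH].
    by move: P0; congr P; apply/funext => x; rewrite big_nil.
  under eq_fun do rewrite big_cons.
  by apply: PD => //; apply: PM; apply: P1; exact: measurable_funPTI.
have := Pl (fun n x => g n x + (- K)) h (K + K + K) .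
apply.
- by move=> n; apply: (PD _ (cst (- K))).
- move=> n x; have := gle n x => /andP[g0 gK]; have := hK x => /ler_normlP [? ?].
  by apply/ler_normlP; split; lra.
- move=> x; rewrite -[h x](addrK K); apply: cvgD => //; exact: cvg_cst.
Qed.

End bounded_measurable.

(** * Integrals of bounded functions against an integrable density *)

Section bounded_multipliers.
Context d (T : measurableType d) (R : realType).
Variables (mu : {measure set T -> \bar R}) (f : T -> R).
Hypothesis intf : mu.-integrable setT (EFin \o f).

Lemma integrable_bounded_measurableM (h : T -> R) : bounded_measurable h ->
  mu.-integrable setT (EFin \o (fun x => h x * f x)).
Proof.
move=> [mh [K hK]].
have mf : measurable_fun setT f by exact/measurable_EFinP/(measurable_int mu).
apply: (le_integrable _ _ _ (integrableZl measurableT K intf)) => //.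
  by apply/measurable_EFinP; exact: measurable_funM.
move=> x _; rewrite /= lee_fin !normrM ler_wpM2r//.
by rewrite (le_trans (hK x))// ler_norm.
Qed.

Lemma RintegralDM (h k : T -> R) : bounded_measurable h -> bounded_measurable k ->
  \int[mu]_x ((h x + k x) * f x) = \int[mu]_x (h x * f x) + \int[mu]_x (k x * f x).
Proof.
move=> bh bk; rewrite -RintegralD//; [|exact: integrable_bounded_measurableM..].
by apply: eq_Rintegral => x _; rewrite mulrDl.
Qed.

Lemma RintegralZM c (h : T -> R) : bounded_measurable h ->
  \int[mu]_x (c * h x * f x) = c * \int[mu]_x (h x * f x).
Proof.
move=> bh; rewrite -RintegralZl//; [|exact: integrable_bounded_measurableM].
by apply: eq_Rintegral => x _; rewrite mulrA.
Qed.

(** Dominated convergence with majorant [K |f|]. *)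
Lemma Rintegral_bounded_cvg (h_ : nat -> T -> R) (h : T -> R) (K : R) :
  (forall n, measurable_fun setT (h_ n)) -> (forall n x, `|h_ n x| <= K) ->
  (forall x, h_ n x @[n --> \oo] --> h x) ->
  \int[mu]_x (h_ n x * f x) @[n --> \oo] --> \int[mu]_x (h x * f x).
Proof.
move=> mh_ h_K hh.
have bh := bounded_measurable_cvg mh_ h_K hh.
have bh_ n : bounded_measurable (h_ n) by split => //; exists K.
have mint k : bounded_measurable k -> measurable_fun setT (fun x => (k x * f x)%:E).
  by move=> /integrable_bounded_measurableM/(measurable_int mu).
apply: fine_cvg; rewrite fineK; last first.
  by apply: integrable_fin_num => //; exact: integrable_bounded_measurableM.
have [] := @dominated_convergence _ _ _ mu setT measurableT
  (fun n x => (h_ n x * f x)%:E) (fun x => (h x * f x)%:E) (fun x => K%:E * `|(f x)%:E|)%E.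
- by move=> n; exact: mint.
- exact: mint.
- by apply: aeW => x _; apply: cvg_EFin; [exact: nearW|apply: cvgM; [exact: hh|exact: cvg_cst]].
- exact/integrableZl/integrable_abse.
- by apply: aeW => x n _ /=; rewrite -!EFinM lee_fin normrM ler_wpM2r.
by [].
Qed.

End bounded_multipliers.

(** * Polynomial approximation of a step function *)

Section soft_step.
Variable R : realType.
Implicit Types u x y : R.

(** Bernoulli's inequality; the induction step discards the term [n x^2]. *)
Lemma one_sub_expr_ge x n : 0 <= x <= 1 -> 1 - n%:R * x <= (1 - x) ^+ n.
Proof.
move=> /andP[x0 x1]; elim: n => [|n IH]; first by rewrite mul0r subr0 expr0.
rewrite exprS (le_trans _ (ler_wpM2l _ IH)) ?subr_ge0//.
have : 0 <= n%:R * x * x by rewrite !mulr_ge0.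
by rewrite -natr1; nra.
Qed.

(** The companion bound [(1 - x)^n <= 1 / (1 + n x)], by induction from
    [(1 + (n + 1) x) (1 - x) <= 1 + n x]. *)
Lemma one_sub_expr_le x n : 0 <= x <= 1 -> (1 + n%:R * x) * (1 - x) ^+ n <= 1.
Proof.
move=> /andP[x0 x1]; elim: n => [|n IH]; first by rewrite mul0r addr0 expr0 mulr1.
rewrite exprS mulrA (le_trans _ IH)// ler_wpM2r ?exprn_ge0 ?subr_ge0//.
have : 0 <= n%:R * x * x by rewrite !mulr_ge0.
by rewrite -natr1; nra.
Qed.

(* These polynomials in [u] converge on [0, 1], boundedly, to a step function
   jumping at 1/2.  Their limit at 1/2 is 1/e, but only its existence matters. *)
Definition soft_step u n := (1 - u ^+ n) ^+ (2 ^ n).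

Lemma soft_step_itv u n : 0 <= u <= 1 -> 0 <= soft_step u n <= 1.
Proof.
move=> /andP[u0 u1]; have un1 := exprn_ile1 n u0 u1.
have /andP[v0 v1] : 0 <= 1 - u ^+ n <= 1 by rewrite subr_ge0 un1 gerBl exprn_ge0.
by rewrite /soft_step exprn_ge0//= exprn_ile1.
Qed.

(** Put [q = 2^-n]. The sequence passes from [(1 - q)^(2^n)] to [((1 - q/2)^2)^(2^n)], and
    [(1 - q/2)^2 = 1 - q + q^2/4], so it increases; it is bounded by 1. *)
Lemma cvg_soft_step_half : cvg (soft_step 2^-1 n @[n --> \oo]).
Proof.
apply: nondecreasing_is_cvgn.
  apply/nondecreasing_seqP => n; rewrite /soft_step expnS exprM.
  have h1 m : 0 <= 1 - 2^-1 ^+ m :> R by rewrite subr_ge0 exprn_ile1 ?invf_le1 ?ler1n.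
  rewrite lerXn2r ?nnegrE ?exprn_ge0//.
  by rewrite (exprS _ n); have := sqr_ge0 (2^-1 ^+ n : R); lra.
exists 1 => _ [n _ <-].
have /andP[] // : 0 <= soft_step 2^-1 n <= 1.
by apply: soft_step_itv; lra.
Qed.

(** Bernoulli's inequality at [u^n] with exponent [2^n] squeezes the sequence between [1 - (2u)^n]
    and 1, where [2u < 1]. *)
Lemma cvg_soft_step_lt u : 0 <= u < 2^-1 -> soft_step u n @[n --> \oo] --> (1 : R).
Proof.
move=> /andP[u0 u2].
have uI n : 0 <= u ^+ n <= 1 by rewrite exprn_ge0//= exprn_ile1//; lra.
apply: (@squeeze_cvgr _ _ _ _ (fun n => 1 - (2 * u) ^+ n) (cst 1)).
- apply: nearW => n; have /andP[_ ->] : 0 <= soft_step u n <= 1 by apply: soft_step_itv; lra.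
  rewrite andbT.
  by rewrite exprMn -natrX; exact: one_sub_expr_ge.
- rewrite -[X in _ --> X]subr0; apply: cvgB; first exact: cvg_cst.
  by apply: cvg_expr; rewrite ger0_norm; lra.
- exact: cvg_cst.
Qed.

(** The companion bound gives [soft_step u n <= (2u)^-n], where [2u > 1]. *)
Lemma cvg_soft_step_gt u : 2^-1 < u <= 1 -> soft_step u n @[n --> \oo] --> (0 : R).
Proof.
move=> /andP[u2 u1].
have u0 : 0 < u by lra.
have uI n : 0 <= u ^+ n <= 1 by rewrite exprn_ge0//= ?exprn_ile1//; lra.
apply: (@squeeze_cvgr _ _ _ _ (cst 0) (fun n => (2 * u)^-1 ^+ n)).
- apply: nearW => n; have /andP[s0 _] : 0 <= soft_step u n <= 1 by apply: soft_step_itv; lra.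
  rewrite s0 andTb.
  rewrite exprVn -[leRHS]mul1r ler_pdivlMr ?exprn_gt0//; last by lra.
  have := one_sub_expr_le (2 ^ n) (uI n); rewrite -/(soft_step u n) natrX exprMn.
  by move: s0; nra.
- exact: cvg_cst.
- apply: cvg_expr; rewrite ger0_norm ?invr_ge0; last by lra.
  by rewrite invf_lt1; lra.
Qed.

End soft_step.

(** * Uniqueness of the Fourier transform *)

Section fourier_uniqueness.
Context d (T : measurableType d) (R : realType).
Variables (mu : {measure set T -> \bar R}) (f : T -> R) (Y : T -> R).
Hypothesis intf : mu.-integrable setT (EFin \o f).
Hypothesis mY : measurable_fun setT Y.
Hypothesis cosf0 : forall s c, \int[mu]_x (cos (s * Y x + c) * f x) = 0.

(* [annihilated] is stable under products with cosines, hence [multiplier]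
   contains the trigonometric polynomials; being stable under bounded pointwise
   limits as well, it contains everything. *)
Let annihilated (h : R -> R) : Prop := bounded_measurable h /\
  forall s c, \int[mu]_x (h (Y x) * cos (s * Y x + c) * f x) = 0.

Let multiplier (k : R -> R) : Prop := bounded_measurable k /\
  forall h, annihilated h -> annihilated (fun y => k y * h y).

Let affine_measurable (s c : R) : measurable_fun setT (fun y : R => s * y + c).
Proof. by apply: measurable_funD => //; exact: measurable_funM. Qed.

Let bounded_cosY s c : bounded_measurable (fun x => cos (s * Y x + c)).
Proof.
by apply: bounded_measurable_cos; exact: measurableT_comp (affine_measurable s c) mY.
Qed.

Let bounded_comp (h : R -> R) :
  bounded_measurable h -> bounded_measurable (fun x => h (Y x)).
Proof.
by move=> [mh [K hK]]; split; [exact: measurableT_comp mh mY|exists K => x].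
Qed.

Let bounded_compM (h : R -> R) s c : bounded_measurable h ->
  bounded_measurable (fun x => h (Y x) * cos (s * Y x + c)).
Proof. by move=> bh; apply: bounded_measurableM => //; exact: bounded_comp. Qed.

Let annihilated1 : annihilated (cst 1).
Proof.
split; first exact: bounded_measurable_cst.
by move=> s c; under eq_Rintegral do rewrite mul1r; exact: cosf0.
Qed.

Let annihilatedD h k : annihilated h -> annihilated k ->
  annihilated (fun y => h y + k y).
Proof.
move=> [bh h0] [bk k0]; split; first exact: bounded_measurableD.
move=> s c; under eq_Rintegral do rewrite mulrDl.
by rewrite (RintegralDM intf) ?h0 ?k0 ?addr0//; exact: bounded_compM.
Qed.

Let annihilatedZ r h : annihilated h -> annihilated (fun y => r * h y).
Proof.
move=> [bh h0]; split.
  by apply: bounded_measurableM => //; exact: bounded_measurable_cst.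
move=> s c; under eq_Rintegral do rewrite -[r * _ * _]mulrA.
by rewrite (RintegralZM intf) ?h0 ?mulr0//; exact: bounded_compM.
Qed.

Let annihilated_cvg (h_ : nat -> R -> R) (h : R -> R) (K : R) :
  (forall n, annihilated (h_ n)) -> (forall n y, `|h_ n y| <= K) ->
  (forall y, h_ n y @[n --> \oo] --> h y) -> annihilated h.
Proof.
move=> Ah_ h_K hh.
split; first by apply: (bounded_measurable_cvg _ h_K hh) => n; case: (Ah_ n) => -[].
move=> s c; apply/esym.
have : \int[mu]_x (h_ n (Y x) * cos (s * Y x + c) * f x) @[n --> \oo] -->
    \int[mu]_x (h (Y x) * cos (s * Y x + c) * f x).
  apply: (@Rintegral_bounded_cvg _ _ _ _ _ intf
    (fun n x => h_ n (Y x) * cos (s * Y x + c)) (fun x => h (Y x) * cos (s * Y x + c)) K).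
  - move=> n; apply: measurable_funM; last by case: (bounded_cosY s c).
    by case: (Ah_ n) => -[mh_ _] _; exact: measurableT_comp mh_ mY.
  - move=> n x; rewrite normrM -[K]mulr1 ler_pM//; exact: cos_max.
  - by move=> x; apply: cvgM; [exact: hh|exact: cvg_cst].
have -> : (fun n => \int[mu]_x (h_ n (Y x) * cos (s * Y x + c) * f x)) = cst 0.
  by apply/funext => n; case: (Ah_ n).
by move=> c0; apply: (cvg_unique (@Rhausdorff R) _ c0); exact: cvg_cst.
Qed.

Let multiplier_cst r : multiplier (cst r).
Proof. by split; [exact: bounded_measurable_cst|move=> h; exact: annihilatedZ]. Qed.

Let multiplierD k l : multiplier k -> multiplier l ->
  multiplier (fun y => k y + l y).
Proof.
move=> [bk Mk] [bl Ml]; split; first exact: bounded_measurableD.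
move=> h Ah; under eq_fun do rewrite mulrDl.
by apply: annihilatedD; [exact: Mk|exact: Ml].
Qed.

Let multiplierM k l : multiplier k -> multiplier l ->
  multiplier (fun y => k y * l y).
Proof.
move=> [bk Mk] [bl Ml]; split; first exact: bounded_measurableM.
by move=> h Ah; under eq_fun do rewrite -mulrA; apply: Mk; exact: Ml.
Qed.

Let multiplierB1 k : multiplier k -> multiplier (fun y => 1 - k y).
Proof.
move=> Mk; apply: multiplierD; first exact: multiplier_cst.
under eq_fun do rewrite -mulN1r.
exact: (multiplierM (multiplier_cst _)).
Qed.

Let multiplierX k n : multiplier k -> multiplier (fun y => k y ^+ n).
Proof.
move=> Mk; elim: n => [|n IH]; first exact: multiplier_cst.
by under eq_fun do rewrite exprS; exact: multiplierM.
Qed.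

Let multiplier_cvg (k_ : nat -> R -> R) (k : R -> R) (K : R) :
  (forall n, multiplier (k_ n)) -> (forall n y, `|k_ n y| <= K) ->
  (forall y, k_ n y @[n --> \oo] --> k y) -> multiplier k.
Proof.
move=> Mk_ k_K kk; split.
  by apply: (bounded_measurable_cvg _ k_K kk) => n; case: (Mk_ n) => -[].
move=> h Ah; have [[_ [L hL]] _] := Ah.
apply: (@annihilated_cvg (fun n y => k_ n y * h y) _ (K * L)).
- by move=> n; case: (Mk_ n) => _; apply.
- by move=> n y; rewrite normrM ler_pM.
- by move=> y; apply: cvgM; [exact: kk|exact: cvg_cst].
Qed.

(** The product of two cosines is half the sum of the cosines of the sum and of the difference, and
    both of the resulting integrals vanish. *)
Let multiplier_cos s c : multiplier (fun y => cos (s * y + c)).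
Proof.
have bcos : bounded_measurable (fun y : R => cos (s * y + c)).
  by apply: bounded_measurable_cos; exact: affine_measurable.
split => // h [bh h0]; split; first exact: bounded_measurableM.
move=> s' c'; rewrite -[RHS](mulr0 2^-1).
rewrite -[X in _ = _ * X](addr0 0) -{1}(h0 (s + s') (c + c')) -(h0 (s - s') (c - c')).
rewrite -(RintegralDM intf); [|exact: bounded_compM..].
rewrite -(RintegralZM intf); last by apply: bounded_measurableD; exact: bounded_compM.
apply: eq_Rintegral => x _; congr (_ * _).
have -> : (s + s') * Y x + (c + c') = (s * Y x + c) + (s' * Y x + c') by ring.
have -> : (s - s') * Y x + (c - c') = (s * Y x + c) - (s' * Y x + c') by ring.
by move: (s * Y x + c) (s' * Y x + c') => A B; rewrite cosD cosB; field.
Qed.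

Let multiplier_sin s a : multiplier (fun y => sin (s * (y - a))).
Proof.
under eq_fun => y do rewrite -cosBpihalf mulrBr -addrA.
exact: multiplier_cos.
Qed.

Let soft_half : R := lim (soft_step (2^-1 : R) n @[n --> \oo]).

(** The soft steps are polynomials in [u = (1 + sin) / 2], which lies in [0, 1] and is below 1/2
    exactly where the sine is negative. *)
Let multiplier_sin_lt0 s a : multiplier
  (fun y => if sin (s * (y - a)) < 0 then 1
            else if sin (s * (y - a)) == 0 then soft_half else 0).
Proof.
pose u y := 2^-1 * (1 + sin (s * (y - a))).
have u01 y : 0 <= u y <= 1.
  by have := sin_geN1 (s * (y - a)); have := sin_le1 (s * (y - a)); rewrite /u; lra.
apply: (@multiplier_cvg (fun n y => soft_step (u y) n) _ 1).
- move=> n; apply/multiplierX/multiplierB1/multiplierX/multiplierM.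
    exact: multiplier_cst.
  by apply: multiplierD; [exact: multiplier_cst|exact: multiplier_sin].
- move=> n y; have /andP[s0 s1] := soft_step_itv n (u01 y).
  by rewrite ger0_norm.
- move=> y; have := u01 y; rewrite /u; case: ltgtP => s0 u1.
  + by apply: cvg_soft_step_lt; lra.
  + by apply: cvg_soft_step_gt; lra.
  + by rewrite s0 addr0 mulr1; exact: cvg_soft_step_half.
Qed.

Let soft_half_itv : 0 <= soft_half <= 1.
Proof.
apply/andP; split.
- apply: limr_ge; first exact: cvg_soft_step_half.
  by apply: nearW => n; have /andP[] // : 0 <= soft_step (2^-1 : R) n <= 1; apply: soft_step_itv; lra.
- apply: limr_le; first exact: cvg_soft_step_half.
  by apply: nearW => n; have /andP[] // : 0 <= soft_step (2^-1 : R) n <= 1; apply: soft_step_itv; lra.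
Qed.

(** Stretching the sine by the factor [n + 1] pushes its other sign changes to infinity: once
    [|y - a| / (n + 1) < pi], the sine has the sign of [y - a]. *)
Let multiplier_lt_eq a : multiplier
  (fun y => if y < a then 1 else if y == a then soft_half else 0).
Proof.
apply: (multiplier_cvg (K := 1) (fun n => multiplier_sin_lt0 n.+1%:R^-1 a)).
  move=> n y; case: ifP => _; first by rewrite normr1.
  by case: ifP => _; rewrite ?normr0// ger0_norm; case/andP: soft_half_itv.
move=> y; apply: cvg_near_cst.
have small : \forall n \near \oo, `|n.+1%:R^-1 * (y - a)| < pi.
  have : n.+1%:R^-1 * (y - a) @[n --> \oo] --> (0 * (y - a) : R).
    by apply: cvgM; [exact: cvg_harmonic|exact: cvg_cst].
  rewrite mul0r => h; apply: (cvgr_norm_lt _ h); rewrite normr0; exact: pi_gt0.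
near=> n.
have n0 : 0 < n.+1%:R^-1 :> R by rewrite invr_gt0.
have : `|n.+1%:R^-1 * (y - a)| < pi by near: n.
set z := n.+1%:R^-1 * (y - a); move=> zpi.
case: (ltgtP y a) => ya.
- have z0 : z < 0 by rewrite /z pmulr_rlt0// subr_lt0.
  have : 0 < sin (- z) by apply: sin_gt0_pi; move: zpi; rewrite ltr0_norm// => ->; rewrite oppr_gt0 z0.
  by rewrite sinN oppr_gt0 => ->.
- have z0 : 0 < z by rewrite /z pmulr_rgt0// subr_gt0.
  have s0 : 0 < sin z by apply: sin_gt0_pi; move: zpi; rewrite gtr0_norm// => ->; rewrite z0.
  by rewrite ltNge (ltW s0)/= gt_eqF.
- by rewrite /z ya subrr mulr0 sin0 ltxx eqxx.
Unshelve. all: by end_near. Qed.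

(** Thresholds increasing to [a] from below remove the value [soft_half]: a point [y < a] is
    eventually below them, and a point [y >= a] is always above. *)
Let multiplier_lt a : multiplier \1_(`]-oo, a[).
Proof.
apply: (multiplier_cvg (K := 1) (fun n => multiplier_lt_eq (a - n.+1%:R^-1))).
  move=> n y; case: ifP => _; first by rewrite normr1.
  by case: ifP => _; rewrite ?normr0// ger0_norm; case/andP: soft_half_itv.
move=> y; apply: cvg_near_cst; rewrite indicE; have [ya|ay] := ltP y a.
- rewrite mem_set/= ?in_itv//=.
  have : n.+1%:R^-1 @[n --> \oo] --> (0 : R) by exact: cvg_harmonic.
  move=> /cvgr_lt/(_ (a - y)); rewrite subr_gt0 => /(_ ya); apply: filterS => n.
  by move=> na; rewrite ltrBrDl -ltrBrDr ifT.
- apply: nearW => n; have n0 : 0 < n.+1%:R^-1 :> R by rewrite invr_gt0.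
  rewrite memNset; last by rewrite /= in_itv/= ltNge ay.
  have ay' : a - n.+1%:R^-1 < y by rewrite (lt_le_trans _ ay)// gtrBl.
  by rewrite ltNge (ltW ay')/= gt_eqF.
Qed.

(** The sets whose indicator is a multiplier form a sigma-algebra containing the open left rays. *)
Let multiplier_indic (B : set R) : measurable B -> multiplier \1_B.
Proof.
rewrite [measurable]RGenInftyO.measurableE.
apply: (smallest_sub (C := sigma_algebra setT)
  (X := [set A : set R | multiplier \1_A])); last first.
  by move=> _ [a ->]; exact: multiplier_lt.
split => /=.
- by rewrite indic0; exact: multiplier_cst.
- move=> A MA; rewrite setTD; have -> : \1_(~` A) = fun y => 1 - \1_A y :> R.
    by apply/funext => y; rewrite !indicE in_setC; case: (_ \in _); rewrite ?subrr ?subr0.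
  exact: multiplierB1.
- move=> A MA; have -> : \1_(\bigcup_k A k) = fun y => 1 - (1 - \1_(\bigcup_k A k) y) :> R.
    by apply/funext => y; rewrite opprB addrCA subrr addr0.
  apply: multiplierB1.
  (* The complement of the union has as indicator the limit of the finite products of the indicators
     of the complements. *)
  apply: (@multiplier_cvg (fun n y => \prod_(i < n) (1 - \1_(A i) y)) _ 1).
  + elim=> [|n IH]; first by under eq_fun do rewrite big_ord0; exact: multiplier_cst.
    under eq_fun do rewrite big_ord_recr/=.
    by apply: multiplierM => //; exact/multiplierB1/MA.
  + move=> n y; rewrite normr_prod; elim: n => [|n IH]; first by rewrite big_ord0.
    rewrite big_ord_recr/= -[leRHS]mulr1 ler_pM//; first exact: prodr_ge0.
    by rewrite indicE; case: (_ \in _); rewrite ?subrr ?normr0// subr0 normr1.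
  + move=> y; apply: cvg_near_cst; rewrite [X in 1 - X]indicE; have [/set_mem[i _ Ai]|] := boolP (y \in _).
      exists i.+1 => // n /= ni; rewrite subrr (bigD1 (Ordinal ni))//= indicE mem_set// subrr mul0r//.
    move=> /negP yA; apply: nearW => n; rewrite subr0 big1// => i _.
    rewrite indicE memNset ?subr0// => Ai; apply: yA; apply/mem_set; exists i => //.
Qed.

(** Every bounded measurable [h] is a multiplier; apply it to the annihilated constant 1 and test
    with [cos 0]. *)
Lemma fourier_uniqueness (h : R -> R) : bounded_measurable h ->
  \int[mu]_x (h (Y x) * f x) = 0.
Proof.
move=> bh.
have [_ /(_ _ annihilated1)[_ /(_ 0 0)]] : multiplier h.
  apply: (bounded_measurable_ind (P := multiplier)) bh => [||c k Mk|k_ k K].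
  - exact: multiplier_indic.
  - exact: multiplierD.
  - exact: multiplierM (multiplier_cst c) Mk.
  - exact: multiplier_cvg.
by under eq_Rintegral do rewrite mul0r addr0 cos0 !mulr1.
Qed.

End fourier_uniqueness.

(** * Change of variables for charges given by a density *)

Section charge_integral_image.
Context d (T : measurableType d) d' (S : measurableType d') (R : realType).

(** Both sides are linear in [F] and respect bounded pointwise limits, so indicators suffice; for
    these the Jordan decomposition gives back [nu A]. *)
Lemma charge_integral_image (mu : {measure set S -> \bar R}) (phi : S -> T)
    (nu : {charge set T -> \bar R}) (f : S -> R) (F : T -> R) :
  measurable_fun setT phi -> mu.-integrable setT (EFin \o f) ->
  (forall A, measurable A -> nu A = \int[mu]_(t in phi @^-1` A) (f t)%:E)%E ->
  bounded_measurable F ->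
  charge_integral nu F = \int[mu]_t (F (phi t) * f t).
Proof.
move=> mphi intf nuE bF; rewrite /charge_integral.
set m1 := jordan_pos _; set m2 := jordan_neg _.
(* With the constant density 1, the rules for integrals of [h x * f x] also apply to the two Jordan
   parts. *)
have int1 (m : {finite_measure set T -> \bar R}) : m.-integrable setT (EFin \o cst 1).
  exact: finite_measure_integrable_cst.
suff [_] : bounded_measurable F /\
    \int[m1]_x (F x * cst 1 x) - \int[m2]_x (F x * cst 1 x) =
    \int[mu]_t (F (phi t) * f t).
  by move=> <-; congr (_ - _); apply: eq_Rintegral => x _; rewrite mulr1.
have bcomp h : bounded_measurable h -> bounded_measurable (fun t => h (phi t)).
  by move=> [mh [K hK]]; split; [exact: measurableT_comp mh mphi|exists K => t].
pose P h := bounded_measurable h /\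
  \int[m1]_x (h x * cst 1 x) - \int[m2]_x (h x * cst 1 x) =
  \int[mu]_t (h (phi t) * f t).
apply: (bounded_measurable_ind (P := P)) bF.
- move=> A mA; split; first exact: bounded_measurable_indic.
  have ind (m : {finite_measure set T -> \bar R}) :
      \int[m]_x (\1_A x * cst 1 x) = fine (m A).
    under eq_Rintegral do rewrite mulr1.
    by rewrite /Rintegral integral_indic// setIT.
  rewrite !ind -fineB ?fin_num_measure//.
  have -> : (m1 A - m2 A = nu A)%E.
    by rewrite (jordan_decomp (hahn_pos_neg nu) mA) /cadd/= cscaleN1.
  rewrite nuE// -/(Rintegral mu _ _) Rintegral_mkcond; apply: eq_Rintegral => t _.
  rewrite patchE indicE; have -> : (phi t \in A) = (t \in phi @^-1` A) by apply/idP/idP; rewrite !inE.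
  by case: ifP => _; rewrite ?mul1r ?mul0r.
- move=> h k [bh hE] [bk kE]; split; first exact: bounded_measurableD.
  rewrite !(RintegralDM (int1 _)) ?(RintegralDM intf) -?hE -?kE; [ring|..] => //; exact: bcomp.
- move=> c h [bh hE]; split.
    by apply: bounded_measurableM => //; exact: bounded_measurable_cst.
  rewrite !(RintegralZM (int1 _)) ?(RintegralZM intf) -?hE; [ring|..] => //; exact: bcomp.
- move=> h_ h K Ph_ h_K hh; have mh_ n : measurable_fun setT (h_ n) by case: (Ph_ n) => -[].
  split; first exact: (bounded_measurable_cvg mh_ h_K hh).
  have cl : \int[m1]_x (h_ n x * cst 1 x) - \int[m2]_x (h_ n x * cst 1 x) @[n --> \oo] -->
      \int[m1]_x (h x * cst 1 x) - \int[m2]_x (h x * cst 1 x).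
    by apply: cvgB; exact: (Rintegral_bounded_cvg (int1 _) mh_ h_K hh).
  have cr : \int[mu]_t (h_ n (phi t) * f t) @[n --> \oo] --> \int[mu]_t (h (phi t) * f t).
    apply: (Rintegral_bounded_cvg intf (K := K)) => [n|n t|t]; last 2 first.
    + exact: h_K.
    + exact: hh.
    + exact: measurableT_comp (mh_ n) mphi.
  apply: (cvg_unique (@Rhausdorff R) cl).
  by move: cr; under eq_fun do rewrite -(Ph_ _).2.
Qed.

End charge_integral_image.

(** * Densities of measures on the curve *)

Section curve_densities.
Variable R : realType.
Implicit Types (nu : {charge set (plane R) -> \bar R}) (f : R -> R).

Local Notation lambda := (@lebesgue_measure R).
Local Notation gamma := (@exp_sq_curve R).

Lemma is_derive_exp_sq (t : R) :
  is_derive t 1 (fun s : R => expR (s ^+ 2)) (2 * t * expR (t ^+ 2)).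
Proof.
apply: is_derive_eq; rewrite /GRing.scale/=; ring.
Qed.

Lemma continuous_exp_sq : continuous (fun t : R => expR (t ^+ 2)).
Proof.
move=> t; apply: continuous_comp; first exact: exprn_continuous.
exact: continuous_expR.
Qed.

Lemma measurable_curve :
  measurable_fun setT (gamma : measurableTypeR R -> plane R).
Proof.
apply: measurable_fun_pair; first exact: measurable_id.
exact: continuous_measurable_fun continuous_exp_sq.
Qed.

Lemma speed_curveE :
  speed gamma = fun t => Num.sqrt (1 + (2 * t * expR (t ^+ 2)) ^+ 2).
Proof.
apply/funext => t; rewrite /speed /exp_sq_curve/= !derive1E.
rewrite derive_id expr1n; congr (Num.sqrt (1 + _ ^+ 2)).
by case: (is_derive_exp_sq t) => _ ->.
Qed.

Lemma measurable_speed_curve : measurable_fun setT (speed gamma).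
Proof.
rewrite speed_curveE.
apply: (measurableT_comp (continuous_measurable_fun (@sqrt_continuous R))).
apply: measurable_funD => //; apply: measurable_funX; apply: measurable_funM.
  exact: measurable_funM.
exact: continuous_measurable_fun continuous_exp_sq.
Qed.

Lemma speed_curve_ge1 t : 1 <= speed gamma t.
Proof.
rewrite speed_curveE -[leLHS]sqrtr1 ler_wsqrtr// lerDl; exact: sqr_ge0.
Qed.

(** The density is taken with respect to [dt] in the parameter; as the speed is at least 1, this
    measure has the same null sets as arc length. *)
Definition curve_density nu f : Prop :=
  lambda.-integrable setT (EFin \o f) /\
  forall A : set (plane R), measurable A ->
    (nu A = \int[lambda]_(t in gamma @^-1` A) (f t)%:E)%E.

Lemma measurable_curve_preimage (A : set (plane R)) :
  measurable A -> measurable (gamma @^-1` A).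
Proof. by move=> mA; rewrite -[X in measurable X]setTI; exact: measurable_curve. Qed.

(** The curve is a graph, so [nu] is determined by its projection to the first coordinate; [f] is
    the Radon-Nikodym derivative of that projection. *)
Lemma curve_density_exists nu :
  (forall A : set (plane R), measurable A -> A `&` range gamma = set0 -> nu A = 0%E) ->
  (forall A : set (plane R), measurable A -> arc_length gamma A = 0%E -> nu A = 0%E) ->
  exists f, curve_density nu f.
Proof.
move=> nu_supp nu_arc.
pose nu1 : {charge set (measurableTypeR R) -> \bar R} :=
  charge.measure_function_pushforward__canonical__charge_Charge nu
    (@measurable_fst _ _ (measurableTypeR R) (measurableTypeR R)).
have nu1_dom : nu1 `<< lambda.
  apply/null_content_dominatesP => B mB B0.
  have mfB : measurable ((@fst R R) @^-1` B : set (plane R)).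
    by rewrite -[X in measurable X]setTI; exact: measurable_fst.
  (* The curve lies in the cylinder over [B] exactly at the parameters in [B], so the arc length is
     an integral over a null set. *)
  apply: nu_arc => //; rewrite /arc_length; apply: null_set_integral => //.
  by apply/measurable_EFinP; apply: measurable_funTS; exact: measurable_speed_curve.
pose f t := fine (Radon_Nikodym nu1 lambda t).
have fE : EFin \o f = Radon_Nikodym nu1 lambda.
  by apply/funext => t; rewrite /= fineK// Radon_Nikodym_fin_num.
exists f; split; first by rewrite fE; exact: Radon_Nikodym_integrable.
move=> A mA; pose C : set (plane R) := (@fst R R) @^-1` (gamma @^-1` A).
have mgA := measurable_curve_preimage mA.
have mC : measurable C by rewrite -[X in measurable X]setTI; exact: measurable_fst.
(* [A] and [C] contain the same points of the curve, so both differences miss it and have measure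
   0. *)
have nuAC : nu A = nu C.
  rewrite (chargeDI nu mA mC) (chargeDI nu mC mA) setIC; congr (_ + _)%E.
  rewrite !nu_supp//; try exact: measurableD.
  - by apply/seteqP; split => // p [[Cp nAp] [t _ tp]]; apply: nAp; move: Cp; rewrite -tp.
  - by apply/seteqP; split => // p [[Ap nCp] [t _ tp]]; apply: nCp; rewrite -tp /C/= tp.
rewrite nuAC; have := Radon_Nikodym_integral nu1_dom mgA.
by rewrite -fE => <-.
Qed.

Lemma X_curve_density (mu : complex_measure (plane R) R) : X gamma mu ->
  exists f1 f2, curve_density (mre mu) f1 /\ curve_density (mim mu) f2.
Proof.
have cmE (A : set (plane R)) : measurable A -> cmeasure mu A = 0 ->
    mre mu A = 0%E /\ mim mu A = 0%E.
  move=> mA [/eqP + /eqP]; rewrite !fine_eq0 ?fin_num_measure// => /eqP -> /eqP ->.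
  by [].
move=> [supp arc].
have [||f1 df1] := @curve_density_exists (mre mu).
- by move=> A mA /(supp _ mA)/(cmE _ mA)[].
- by move=> A mA /(arc _ mA)/(cmE _ mA)[].
have [||f2 df2] := @curve_density_exists (mim mu).
- by move=> A mA /(supp _ mA)/(cmE _ mA)[].
- by move=> A mA /(arc _ mA)/(cmE _ mA)[].
by exists f1, f2.
Qed.

Lemma curve_density_charge f : lambda.-integrable setT (EFin \o f) ->
  exists nu, curve_density nu f.
Proof.
move=> intf.
exists (charge.measure_function_pushforward__canonical__charge_Charge
  (induced_charge intf) measurable_curve).
by split.
Qed.

Lemma curve_density_X (mu : complex_measure (plane R) R) f1 f2 :
  curve_density (mre mu) f1 -> curve_density (mim mu) f2 -> X gamma mu.
Proof.
move=> [int1 d1] [int2 d2]; split => A mA => [Agamma|A0].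
  rewrite /cmeasure d1// d2//; have -> : gamma @^-1` A = set0.
    apply/seteqP; split => // t At.
    by have : (A `&` range gamma) (gamma t) by []; rewrite Agamma.
  by rewrite !integral_set0.
have mgA := measurable_curve_preimage mA.
have gA0 : lambda (gamma @^-1` A) = 0%E.
  apply/eqP; rewrite eq_le measure_ge0 andbT -[leRHS]A0 -[leLHS]mul1e -integral_cst//.
  rewrite /arc_length; apply: ge0_le_integral => //.
  - by apply/measurable_EFinP; apply: measurable_funTS; exact: measurable_speed_curve.
  - by move=> t _; rewrite lee_fin speed_curve_ge1.
rewrite /cmeasure d1// d2// !null_set_integral//.
- by apply: measurable_funTS; exact: measurable_int int2.
- by apply: measurable_funTS; exact: measurable_int int1.
Qed.

(** These are the two parts of the integral of [e^(-i theta) (f1 + i f2)], with [theta] the argument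
    of the cosines and sines. *)
Lemma fourier_curve_density (mu : complex_measure (plane R) R) f1 f2 (xi : R * R) :
  curve_density (mre mu) f1 -> curve_density (mim mu) f2 ->
  fourier mu xi = Complex
    (\int[lambda]_t (cos (pi * (t * xi.1 + expR (t ^+ 2) * xi.2)) * f1 t) +
     \int[lambda]_t (sin (pi * (t * xi.1 + expR (t ^+ 2) * xi.2)) * f2 t))
    (\int[lambda]_t (cos (pi * (t * xi.1 + expR (t ^+ 2) * xi.2)) * f2 t) -
     \int[lambda]_t (sin (pi * (t * xi.1 + expR (t ^+ 2) * xi.2)) * f1 t)).
Proof.
move=> [int1 d1] [int2 d2]; rewrite /fourier /cintegral /expi/=.
have mtheta : measurable_fun setT (fun p : plane R => pi * (p.1 * xi.1 + p.2 * xi.2)).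
  apply: measurable_funM => //; apply: measurable_funD; apply: measurable_funM => //.
have bcos : bounded_measurable
    (fun p : plane R => cos (- (pi * (p.1 * xi.1 + p.2 * xi.2)))).
  by under eq_fun do rewrite cosN; exact: bounded_measurable_cos.
have bsin : bounded_measurable
    (fun p : plane R => sin (- (pi * (p.1 * xi.1 + p.2 * xi.2)))).
  apply: bounded_measurable_sin; exact: measurable_funN.
rewrite (charge_integral_image measurable_curve int1 d1 bcos).
rewrite (charge_integral_image measurable_curve int1 d1 bsin).
rewrite (charge_integral_image measurable_curve int2 d2 bcos).
rewrite (charge_integral_image measurable_curve int2 d2 bsin).
have icos f : \int[lambda]_t
    (cos (- (pi * ((gamma t).1 * xi.1 + (gamma t).2 * xi.2))) * f t) =
    \int[lambda]_t (cos (pi * (t * xi.1 + expR (t ^+ 2) * xi.2)) * f t).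
  by apply: eq_Rintegral => t _; rewrite cosN.
have isin f : lambda.-integrable setT (EFin \o f) -> \int[lambda]_t
    (sin (- (pi * ((gamma t).1 * xi.1 + (gamma t).2 * xi.2))) * f t) =
    - \int[lambda]_t (sin (pi * (t * xi.1 + expR (t ^+ 2) * xi.2)) * f t).
  move=> intf; rewrite -[RHS]mulN1r -(RintegralZM intf); last first.
    apply: bounded_measurable_sin.
    exact: measurableT_comp mtheta measurable_curve.
  by apply: eq_Rintegral => t _; rewrite sinN mulN1r.
rewrite !icos !isin// opprK; congr Complex.
by rewrite addrC.
Qed.

End curve_densities.

(** * Multiplication of a density by a phase *)

Section rotation.
Variables (T : Type) (R : realType).

(* The real and imaginary parts of [e^(-i w) (f1 + i f2)]. *)
Definition rot_re (w f1 f2 : T -> R) x := cos (w x) * f1 x + sin (w x) * f2 x.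
Definition rot_im (w f1 f2 : T -> R) x := cos (w x) * f2 x - sin (w x) * f1 x.

(** Multiplying by [e^(i w)] recovers [f1 + i f2]. *)
Lemma rot_eq0 (w f1 f2 : T -> R) x : rot_re w f1 f2 x = 0 -> rot_im w f1 f2 x = 0 ->
  f1 x = 0 /\ f2 x = 0.
Proof.
rewrite /rot_re /rot_im => h1 h2; have := cos2Dsin2 (w x).
set c := cos _ in h1 h2 *; set s := sin _ in h1 h2 * => cs1; split.
- rewrite -[LHS]mul1r -cs1.
  by rewrite (_ : _ * _ = c * (c * f1 x + s * f2 x) - s * (c * f2 x - s * f1 x));
    [rewrite h1 h2; ring|ring].
- rewrite -[LHS]mul1r -cs1.
  by rewrite (_ : _ * _ = s * (c * f1 x + s * f2 x) + c * (c * f2 x - s * f1 x));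
    [rewrite h1 h2; ring|ring].
Qed.

End rotation.

(** * Densities annihilated by functions of [Y] *)

Section annihilation.
Context d (T : measurableType d) (R : realType) (mu : {measure set T -> \bar R}).
Implicit Types f g : T -> R.

Lemma ae_eq0_annihilated f : mu.-integrable setT (EFin \o f) ->
  (forall h, bounded_measurable h -> \int[mu]_x (h x * f x) = 0) ->
  {ae mu, forall x, f x = 0}.
Proof.
move=> intf hf0.
have : ae_eq mu setT (EFin \o f) (cst 0%E).
  apply: integral_ae_eq => // E _ mE; rewrite integral0 /=.
  have fE : (\int[mu]_(x in E) (f x)%:E)%E \is a fin_num.
    by apply: integrable_fin_num => //; exact: integrableS intf.
  rewrite -[LHS]fineK//; congr EFin; rewrite -/(Rintegral mu E f) Rintegral_mkcond.
  rewrite -[RHS](hf0 _ (bounded_measurable_indic R mE)); apply: eq_Rintegral => x _.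
  by rewrite patchE indicE; case: ifP => _; rewrite ?mul1r ?mul0r.
by apply: filterS => x /(_ I) /= [].
Qed.

Section integral_rotation.
Variables (f1 f2 : T -> R).
Hypotheses (int1 : mu.-integrable setT (EFin \o f1))
           (int2 : mu.-integrable setT (EFin \o f2)).

Lemma integrable_rot_re w : measurable_fun setT w ->
  mu.-integrable setT (EFin \o rot_re w f1 f2).
Proof.
move=> mw; exact: (integrableD measurableT
  (integrable_bounded_measurableM int1 (bounded_measurable_cos mw))
  (integrable_bounded_measurableM int2 (bounded_measurable_sin mw))).
Qed.

Lemma integrable_rot_im w : measurable_fun setT w ->
  mu.-integrable setT (EFin \o rot_im w f1 f2).
Proof.
move=> mw; exact: (integrableB measurableT
  (integrable_bounded_measurableM int2 (bounded_measurable_cos mw))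
  (integrable_bounded_measurableM int1 (bounded_measurable_sin mw))).
Qed.

Lemma Rintegral_rot_re (h w : T -> R) : bounded_measurable h -> measurable_fun setT w ->
  \int[mu]_x (h x * rot_re w f1 f2 x) =
  \int[mu]_x (h x * cos (w x) * f1 x) + \int[mu]_x (h x * sin (w x) * f2 x).
Proof.
move=> bh mw; rewrite -RintegralD//.
- by apply: eq_Rintegral => x _; rewrite /rot_re mulrDr !mulrA.
- apply: (integrable_bounded_measurableM int1).
  exact: bounded_measurableM bh (bounded_measurable_cos mw).
- apply: (integrable_bounded_measurableM int2).
  exact: bounded_measurableM bh (bounded_measurable_sin mw).
Qed.

Lemma Rintegral_rot_im (h w : T -> R) : bounded_measurable h -> measurable_fun setT w ->
  \int[mu]_x (h x * rot_im w f1 f2 x) =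
  \int[mu]_x (h x * cos (w x) * f2 x) - \int[mu]_x (h x * sin (w x) * f1 x).
Proof.
move=> bh mw; rewrite -RintegralB//.
- by apply: eq_Rintegral => x _; rewrite /rot_im mulrBr !mulrA.
- apply: (integrable_bounded_measurableM int2).
  exact: bounded_measurableM bh (bounded_measurable_cos mw).
- apply: (integrable_bounded_measurableM int1).
  exact: bounded_measurableM bh (bounded_measurable_sin mw).
Qed.

End integral_rotation.

(** The hypotheses say that the transform of [e^(-i w) (f1 + i f2)] under [Y] vanishes. Each
    condition mixes the real and imaginary parts [F1] and [F2]; as cosine is even and sine odd, the
    conditions at [s] and [- s] together separate them. *)
Lemma fourier_uniqueness_rot f1 f2 (Y w : T -> R) (h : R -> R) :
  mu.-integrable setT (EFin \o f1) -> mu.-integrable setT (EFin \o f2) ->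
  measurable_fun setT Y -> measurable_fun setT w ->
  (forall s, \int[mu]_x (cos (s * Y x + w x) * f1 x) +
             \int[mu]_x (sin (s * Y x + w x) * f2 x) = 0) ->
  (forall s, \int[mu]_x (cos (s * Y x + w x) * f2 x) -
             \int[mu]_x (sin (s * Y x + w x) * f1 x) = 0) ->
  bounded_measurable h ->
  \int[mu]_x (h (Y x) * rot_re w f1 f2 x) = 0 /\
  \int[mu]_x (h (Y x) * rot_im w f1 f2 x) = 0.
Proof.
move=> int1 int2 mY mw re0 im0 bh.
set F1 := rot_re w f1 f2; set F2 := rot_im w f1 f2.
have intF1 : mu.-integrable setT (EFin \o F1) by exact: integrable_rot_re.
have intF2 : mu.-integrable setT (EFin \o F2) by exact: integrable_rot_im.
have msY s : measurable_fun setT (fun x => s * Y x) by exact: measurable_funM.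
have bcos s := bounded_measurable_cos (msY s).
have bsin s := bounded_measurable_sin (msY s).
have msYw s : measurable_fun setT (fun x => s * Y x + w x) by exact: measurable_funD.
have E1 s : \int[mu]_x (cos (s * Y x) * F1 x) + \int[mu]_x (sin (s * Y x) * F2 x) = 0.
  rewrite -(re0 s) -!RintegralD//; try exact: integrable_bounded_measurableM.
  - by apply: eq_Rintegral => x _; rewrite cosD sinD /F1 /F2 /rot_re /rot_im; ring.
  - by apply: integrable_bounded_measurableM => //; exact: bounded_measurable_cos.
  - by apply: integrable_bounded_measurableM => //; exact: bounded_measurable_sin.
have E2 s : \int[mu]_x (cos (s * Y x) * F2 x) - \int[mu]_x (sin (s * Y x) * F1 x) = 0.
  rewrite -(im0 s) -!RintegralB//; try exact: integrable_bounded_measurableM.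
  - by apply: eq_Rintegral => x _; rewrite cosD sinD /F1 /F2 /rot_re /rot_im; ring.
  - by apply: integrable_bounded_measurableM => //; exact: bounded_measurable_cos.
  - by apply: integrable_bounded_measurableM => //; exact: bounded_measurable_sin.
have cosNs s F : \int[mu]_x (cos (- s * Y x) * F x) = \int[mu]_x (cos (s * Y x) * F x).
  by apply: eq_Rintegral => x _; rewrite mulNr cosN.
have sinNs s F : mu.-integrable setT (EFin \o F) ->
    \int[mu]_x (sin (- s * Y x) * F x) = - \int[mu]_x (sin (s * Y x) * F x).
  move=> intF; rewrite -[RHS]mulN1r -(RintegralZM intF) //.
  by apply: eq_Rintegral => x _; rewrite mulNr sinN mulN1r.
have uniq F : mu.-integrable setT (EFin \o F) ->
    (forall s, \int[mu]_x (cos (s * Y x) * F x) = 0) ->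
    (forall s, \int[mu]_x (sin (s * Y x) * F x) = 0) ->
    \int[mu]_x (h (Y x) * F x) = 0.
  move=> intF c0 s0; apply: fourier_uniqueness => // s c.
  have -> : \int[mu]_x (cos (s * Y x + c) * F x) =
      \int[mu]_x ((cos c * cos (s * Y x) + - sin c * sin (s * Y x)) * F x).
    by apply: eq_Rintegral => x _; rewrite cosD; ring.
  have bZ k (r : T -> R) : bounded_measurable r -> bounded_measurable (fun x => k * r x).
    by move=> br; apply: bounded_measurableM => //; exact: bounded_measurable_cst.
  rewrite (RintegralDM intF) ?(RintegralZM intF) ?c0 ?s0 ?mulr0 ?addr0//; exact: bZ.
by split; apply: uniq => // s; have := E1 s; have := E1 (- s);
  have := E2 s; have := E2 (- s); rewrite !cosNs !sinNs//; lra.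
Qed.

End annihilation.

(** * Vanishing of the transform on a line *)

Section lines.
Variable R : realType.

Local Notation lambda := (@lebesgue_measure R).
Local Notation gamma := (@exp_sq_curve R).

Definition phase (v : R * R) (t : R) : R := t * v.1 + expR (t ^+ 2) * v.2.

Lemma measurable_phase v : measurable_fun [set: measurableTypeR R] (phase v).
Proof.
apply: measurable_funD; apply: measurable_funM => //.
exact: (continuous_measurable_fun (@continuous_exp_sq R)).
Qed.

Lemma line_annihilated (mu : complex_measure (plane R) R) f1 f2 (p v : R * R) h :
  curve_density (mre mu) f1 -> curve_density (mim mu) f2 ->
  (forall xi, line p v xi -> fourier mu xi = 0) -> bounded_measurable h ->
  \int[lambda]_t (h (phase v t) * rot_re (fun t => pi * phase p t) f1 f2 t) = 0 /\
  \int[lambda]_t (h (phase v t) * rot_im (fun t => pi * phase p t) f1 f2 t) = 0.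
Proof.
move=> d1 d2 mu0 bh.
(* The parameter [s / pi] absorbs the factor [pi] of the Fourier kernel. *)
have E s t : pi * (t * (p.1 + s / pi * v.1) + expR (t ^+ 2) * (p.2 + s / pi * v.2)) =
    s * phase v t + pi * phase p t :> R.
  by rewrite /phase; move: (lt0r_neq0 (pi_gt0 R)); move: (pi : R) => q q0; field.
have four s := fourier_curve_density (p.1 + s / pi * v.1, p.2 + s / pi * v.2) d1 d2.
have zero s : fourier mu (p.1 + s / pi * v.1, p.2 + s / pi * v.2) = 0.
  by apply: mu0; exists (s / pi).
apply: fourier_uniqueness_rot => //; [exact: d1.1|exact: d2.1|exact: measurable_phase
  |by apply: measurable_funM => //; exact: measurable_phase|..].
- move=> s; have := four s; rewrite zero => -[/esym re0 _]; rewrite -[RHS]re0 /=.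
  by congr (_ + _); apply: eq_Rintegral => t _; rewrite E.
- move=> s; have := four s; rewrite zero => -[_ /esym im0]; rewrite -[RHS]im0 /=.
  by congr (_ - _); apply: eq_Rintegral => t _; rewrite E.
Qed.

Lemma cmeasure_eq0 (mu : complex_measure (plane R) R) f1 f2 w A :
  curve_density (mre mu) f1 -> curve_density (mim mu) f2 ->
  {ae lambda, forall t, rot_re w f1 f2 t = 0} ->
  {ae lambda, forall t, rot_im w f1 f2 t = 0} ->
  measurable A -> cmeasure mu A = 0.
Proof.
move=> [int1 d1] [int2 d2] re0 im0 mA; have mgA := measurable_curve_preimage mA.
have int0 f : lambda.-integrable setT (EFin \o f) -> {ae lambda, forall t, f t = 0} ->
    (\int[lambda]_(t in gamma @^-1` A) (f t)%:E = 0)%E.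
  move=> intf f0; rewrite (ae_eq_integral (cst 0%E))//.
  - by rewrite integral0.
  - by apply: measurable_funTS; exact: measurable_int intf.
  - by move: f0; apply: filterS => t /= -> .
rewrite /cmeasure d1// d2// !int0//.
- apply: (@filterS2 _ _ (ae_filter_ringOfSetsType lambda) _ _ _ _ re0 im0) => t r i.
  by case: (rot_eq0 r i).
- apply: (@filterS2 _ _ (ae_filter_ringOfSetsType lambda) _ _ _ _ re0 im0) => t r i.
  by case: (rot_eq0 r i).
Qed.

Lemma horizontal_line_HUP (p v : R * R) : v.1 != 0 -> v.2 = 0 ->
  heisenberg_uniqueness_pair gamma (line p v).
Proof.
move=> v1 v2 mu Xmu mu0 A mA; have [f1 [f2 [d1 d2]]] := X_curve_density Xmu.
have mw : measurable_fun [set: measurableTypeR R] (fun t => pi * phase p t).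
  by apply: measurable_funM => //; exact: measurable_phase.
have key h : bounded_measurable h ->
    \int[lambda]_t (h t * rot_re (fun t => pi * phase p t) f1 f2 t) = 0 /\
    \int[lambda]_t (h t * rot_im (fun t => pi * phase p t) f1 f2 t) = 0.
  move=> [mh [K hK]].
  (* Here the phase is [t * v.1], so dividing by [v.1] turns any function of [t] into a function of
     the phase. *)
  have bh : bounded_measurable (fun y : R => h (y / v.1)).
    split; last by exists K => x.
    by apply: (measurableT_comp mh); exact: measurable_funM.
  have [h1 h2] := line_annihilated d1 d2 mu0 bh.
  split; [rewrite -[RHS]h1|rewrite -[RHS]h2].
  - by apply: eq_Rintegral => t _; rewrite /phase v2 mulr0 addr0 mulfK.
  - by apply: eq_Rintegral => t _; rewrite /phase v2 mulr0 addr0 mulfK.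
apply: (cmeasure_eq0 (w := fun t => pi * phase p t) d1 d2) => //; apply: ae_eq0_annihilated.
- exact: (integrable_rot_re d1.1 d2.1 mw).
- by move=> h /key[].
- exact: (integrable_rot_im d1.1 d2.1 mw).
- by move=> h /key[].
Qed.

End lines.

(* Subtracting [cos (w (tau y))] and [sin (w (tau y))] times the first two
   conditions from the last two leaves a function that vanishes on the branch
   [x = tau (Y x)]; on the other branch every function of [x] is a function of
   [Y x]. *)
Lemma branch_annihilated d (T : measurableType d) (R : realType)
    (mu : {measure set T -> \bar R}) (f1 f2 : T -> R) (Y w : T -> R)
    (tau tau' : R -> T) :
  mu.-integrable setT (EFin \o f1) -> mu.-integrable setT (EFin \o f2) ->
  measurable_fun setT Y -> measurable_fun setT w ->
  measurable_fun setT tau -> measurable_fun setT tau' ->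
  (forall h : R -> R, bounded_measurable h -> \int[mu]_x (h (Y x) * f1 x) = 0) ->
  (forall h : R -> R, bounded_measurable h -> \int[mu]_x (h (Y x) * f2 x) = 0) ->
  (forall h : R -> R, bounded_measurable h ->
    \int[mu]_x (h (Y x) * rot_re w f1 f2 x) = 0) ->
  (forall h : R -> R, bounded_measurable h ->
    \int[mu]_x (h (Y x) * rot_im w f1 f2 x) = 0) ->
  (forall x, x = tau (Y x) \/ x = tau' (Y x)) ->
  {ae mu, forall x, (f1 x = 0 /\ f2 x = 0) \/ cos (w x - w (tau (Y x))) = 1}.
Proof.
move=> int1 int2 mY mw mtau mtau' hf1 hf2 hre him branch.
pose w' x := w (tau (Y x)).
have mwt : measurable_fun setT (w \o tau) by exact: measurableT_comp.
have mw' : measurable_fun setT w' by exact: (measurableT_comp mwt mY).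
have bt' (h : T -> R) : bounded_measurable h -> bounded_measurable (h \o tau').
  by move=> [mh [K hK]]; split; [exact: measurableT_comp|exists K => x; exact: hK].
have bY (h : R -> R) : bounded_measurable h -> bounded_measurable (h \o Y).
  by move=> [mh [K hK]]; split; [exact: measurableT_comp|exists K => x; exact: hK].
pose P x := rot_re w f1 f2 x - rot_re w' f1 f2 x.
pose Q x := rot_im w f1 f2 x - rot_im w' f1 f2 x.
have intP : mu.-integrable setT (EFin \o P).
  exact: (integrableB measurableT (integrable_rot_re int1 int2 mw)
    (integrable_rot_re int1 int2 mw')).
have intQ : mu.-integrable setT (EFin \o Q).
  exact: (integrableB measurableT (integrable_rot_im int1 int2 mw)
    (integrable_rot_im int1 int2 mw')).
have branchE (F : T -> R) (h : T -> R) x : (x = tau (Y x) -> F x = 0) ->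
    h x * F x = h (tau' (Y x)) * F x.
  by move=> F0; case: (branch x) => [/F0 ->|<-//]; rewrite !mulr0.
have P0 : {ae mu, forall x, P x = 0}.
  apply: ae_eq0_annihilated => // h bh.
  have hP x : h x * P x = h (tau' (Y x)) * rot_re w f1 f2 x -
      h (tau' (Y x)) * rot_re w' f1 f2 x.
    rewrite (branchE P h) ?mulrBr// => xt.
    by rewrite /P /rot_re /w' -xt subrr.
  under eq_Rintegral do rewrite hP.
  rewrite RintegralB//; last 2 first.
  - exact: (integrable_bounded_measurableM (integrable_rot_re int1 int2 mw) (bY _ (bt' _ bh))).
  - exact: (integrable_bounded_measurableM (integrable_rot_re int1 int2 mw') (bY _ (bt' _ bh))).
  rewrite (hre (h \o tau')) ?sub0r; last exact: bt'.
  rewrite (Rintegral_rot_re int1 int2 (bY _ (bt' _ bh)) mw').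
  rewrite (hf1 (fun y => h (tau' y) * cos (w (tau y)))); last first.
    by apply: bounded_measurableM; [exact: bt'|exact: bounded_measurable_cos].
  rewrite (hf2 (fun y => h (tau' y) * sin (w (tau y)))) ?addr0 ?oppr0//.
  by apply: bounded_measurableM; [exact: bt'|exact: bounded_measurable_sin].
have Q0 : {ae mu, forall x, Q x = 0}.
  apply: ae_eq0_annihilated => // h bh.
  have hQ x : h x * Q x = h (tau' (Y x)) * rot_im w f1 f2 x -
      h (tau' (Y x)) * rot_im w' f1 f2 x.
    rewrite (branchE Q h) ?mulrBr// => xt.
    by rewrite /Q /rot_im /w' -xt subrr.
  under eq_Rintegral do rewrite hQ.
  rewrite RintegralB//; last 2 first.
  - exact: (integrable_bounded_measurableM (integrable_rot_im int1 int2 mw) (bY _ (bt' _ bh))).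
  - exact: (integrable_bounded_measurableM (integrable_rot_im int1 int2 mw') (bY _ (bt' _ bh))).
  rewrite (him (h \o tau')) ?sub0r; last exact: bt'.
  rewrite (Rintegral_rot_im int1 int2 (bY _ (bt' _ bh)) mw').
  rewrite (hf2 (fun y => h (tau' y) * cos (w (tau y)))); last first.
    by apply: bounded_measurableM; [exact: bt'|exact: bounded_measurable_cos].
  rewrite (hf1 (fun y => h (tau' y) * sin (w (tau y)))) ?subr0 ?oppr0//.
  by apply: bounded_measurableM; [exact: bt'|exact: bounded_measurable_sin].
apply: filterS2 P0 Q0 => x; rewrite /P /Q /rot_re /rot_im cosB -/(w' x).
have := cos2Dsin2 (w x).
move: (cos (w x)) (sin (w x)) (cos (w' x)) (sin (w' x)) (f1 x) (f2 x).
move=> c s c' s' u v cs1 P0 Q0.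
(* With [z = e^(-i w) - e^(-i w')], this is [|z|^2 |u + i v|^2 = |z (u + i v)|^2]. So either the
   density vanishes or the two phases agree. *)
have : ((c - c') ^+ 2 + (s - s') ^+ 2) * (u ^+ 2 + v ^+ 2) =
    (c * u + s * v - (c' * u + s' * v)) ^+ 2 +
    (c * v - s * u - (c' * v - s' * u)) ^+ 2 by ring.
rewrite P0 Q0 expr0n addr0 => /eqP; rewrite mulf_eq0 !paddr_eq0 ?sqr_ge0// !sqrf_eq0.
move=> /orP[/andP[]|/andP[/eqP -> /eqP ->]]; last by left.
by rewrite !subr_eq0 => /eqP <- /eqP <-; right; rewrite -!expr2.
Qed.

(** Solutions of [cos x = 1] are spaced by more than 1, so their floors label them injectively. If
    [0 < y - x < 1], then [sin ((y - x) / 2) > 0], and the double angle formula makes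
    [cos (y - x) < 1]. *)
Lemma cos_eq1_floor_inj (R : realType) (x y : R) : cos x = 1 -> cos y = 1 ->
  Num.floor x = Num.floor y -> x = y.
Proof.
wlog xy : x y / x <= y => [hwlog cx cy fxy|].
  by case: (leP x y) => [|/ltW] le; [exact: hwlog|apply/esym/hwlog].
move=> cx cy fxy; apply/eqP; rewrite eq_le xy/= leNgt; apply/negP => lt_xy.
have y1 : y < x + 1.
  have /andP[fx _] := floor_itv x; have /andP[_ fy] := floor_itv y.
  by rewrite (lt_le_trans fy)// -fxy intrD lerD2r.
have sx : sin x = 0 by apply: cos1sin0; rewrite cx normr1.
have : cos (y - x) = 1 by rewrite cosB cx cy sx mulr0 addr0 mulr1.
have -> : y - x = ((y - x) / 2) *+ 2 by rewrite -mulr_natr; field.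
have : 0 < sin ((y - x) / 2).
  by apply: sin_gt0_pi; apply/andP; split; [lra|have := pi_ge2 R; lra].
rewrite cos_mulr2n cos2sin2 => s0.
have : 0 < sin ((y - x) / 2) ^+ 2 by rewrite exprn_gt0.
lra.
Qed.

(** * Convexity of the phase and the two branches of its inverse *)

Section branches.
Variables (R : realType) (c : R).

Local Notation Y := (phase (c, 1)).

Lemma phase1E t : Y t = t * c + expR (t ^+ 2).
Proof. by rewrite /phase mulr1. Qed.

Lemma is_derive_phase (t : R) : is_derive t 1 Y (c + 2 * t * expR (t ^+ 2)).
Proof.
have -> : Y = (fun t => t * c + expR (t ^+ 2)) by apply/funext => s; exact: phase1E.
have := is_derive_exp_sq t => D.
apply: is_derive_eq; rewrite /GRing.scale/=; ring.
Qed.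

Lemma continuous_phase : continuous Y.
Proof.
have -> : Y = (fun t => t * c + expR (t ^+ 2)) by apply/funext => s; exact: phase1E.
move=> t; apply: cvgD; last exact: continuous_exp_sq.
by apply: cvgM; [exact: cvg_id|exact: cvg_cst].
Qed.

(** The function [t e^(t^2)] is odd and strictly increasing on the positive half-line. This is the
    strict convexity of [Y]. *)
Lemma phase_derive_lt (x y : R) : x < y ->
  c + 2 * x * expR (x ^+ 2) < c + 2 * y * expR (y ^+ 2).
Proof.
have pos (a b : R) : 0 <= a -> a < b -> a * expR (a ^+ 2) < b * expR (b ^+ 2).
  move=> a0 ab; apply: (@le_lt_trans _ _ (a * expR (b ^+ 2))).
    by rewrite ler_wpM2l// ler_expR ler_sqr ?nnegrE ?(ltW ab)// (le_trans a0 (ltW ab)).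
  by rewrite ltr_pM2r ?expR_gt0.
move=> xy; rewrite ltrD2l -!mulrA ltr_pM2l//.
case: (leP 0 x) => [x0|x0]; first exact: pos.
case: (leP y 0) => [y0|y0].
  have := @pos (- y) (- x); rewrite oppr_ge0 ltrN2 !sqrrN !mulNr ltrN2; exact.
by rewrite (@lt_trans _ _ 0)// ?pmulr_llt0 ?mulr_gt0 ?expR_gt0.
Qed.

(** Otherwise the mean value theorem gives a slope [>= 0] before [y] and a slope [<= 0] after it,
    against the strict growth of the derivative. *)
Lemma phase_quasiconvex (x y z : R) : x < y -> y < z -> Y y < Num.max (Y x) (Y z).
Proof.
move=> xy yz; rewrite ltNge; apply/negP; rewrite ge_max => /andP[Yxy Yzy].
have mvt (a b : R) : a < b -> exists2 e, e \in `]a, b[ &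
    Y b - Y a = (c + 2 * e * expR (e ^+ 2)) * (b - a).
  move=> ab; apply: MVT => // [u _|]; first exact: is_derive_phase.
  by apply: continuous_subspaceT; exact: continuous_phase.
have [e1 /[!in_itv]/= /andP[_ e1y] E1] := mvt _ _ xy.
have [e2 /[!in_itv]/= /andP[ye2 _] E2] := mvt _ _ yz.
have lt12 := phase_derive_lt (lt_trans e1y ye2).
have h1 : 0 <= c + 2 * e1 * expR (e1 ^+ 2).
  by rewrite -(@pmulr_lge0 _ (y - x)) ?subr_gt0// -E1 subr_ge0.
have h2 : c + 2 * e2 * expR (e2 ^+ 2) <= 0.
  by rewrite -(@pmulr_lle0 _ (z - y)) ?subr_gt0// -E2 subr_le0.
lra.
Qed.

(** Coercivity: [Y t >= 1 + t^2 - |c| |t|], which exceeds [y] when [|t|] is larger than the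
    bound. *)
Lemma phase_le_bound (y t : R) : Y t <= y -> `|t| <= `|c| + `|y| + 1.
Proof.
rewrite phase1E => Yty; rewrite leNgt; apply/negP => tK.
have e1 : 1 + t ^+ 2 <= expR (t ^+ 2) by exact: expR_ge1Dx.
have tc : - (`|t| * `|c|) <= t * c by rewrite -normrM lerNnormlW.
have t2 : t ^+ 2 = `|t| * `|t| by rewrite -expr2 real_normK// num_real.
have yy := ler_norm y; have y0 := normr_ge0 y; have t0 := normr_ge0 t; have c0 := normr_ge0 c.
have tt : `|t| * (`|c| + `|y| + 1) <= `|t| * `|t| := ler_wpM2l t0 (ltW tK).
have : `|y| <= `|t| * `|y| by rewrite ler_peMl//; lra.
move: tt; rewrite !mulrDr; lra.
Qed.

(** The branches are the supremum and infimum of the sublevel sets of [Y]. A point strictly between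
    them would lie between two points of its own sublevel set, against quasiconvexity. Monotonicity
    in [y] later gives measurability. *)
Lemma phase_branches : exists tau1 tau2 : R -> R,
  [/\ nondecreasing_fun tau1, nonincreasing_fun tau2 &
      forall t, t = tau1 (Y t) \/ t = tau2 (Y t)].
Proof.
(* Since [Y 0 = 1], a global minimum is attained where [Y t <= 1], and [phase_le_bound] places these
   points in [[- K, K]]. *)
pose K := `|c| + `|1| + 1 : R.
have K0 : 0 <= K by rewrite !addr_ge0.
have [t0 _ t0min] : exists2 t0, t0 \in `[- K, K]%R &
    forall t, t \in `[- K, K]%R -> Y t0 <= Y t.
  apply: EVT_min; first by rewrite ge0_cp.
  by apply: continuous_subspaceT; exact: continuous_phase.
have Yt0 t : Y t0 <= Y t.
  case: (leP (Y t) 1) => [/phase_le_bound tK|lt1].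
    by apply: t0min; rewrite in_itv/= -ler_norml.
  apply: le_trans (ltW lt1); rewrite (le_trans (t0min 0 _))//.
    by rewrite in_itv/= oppr_le0 K0.
  by rewrite phase1E mul0r expr0n expR0 add0r.
(* The maximum keeps [t0] in [S y] even when [y] is below the minimum of [Y]. *)
pose S y := [set t : R | Y t <= Num.max y (Y t0)].
have S0 y : S y t0 by rewrite /S/= le_max lexx orbT.
have Sub y : has_ubound (S y).
  by exists (`|c| + `|Num.max y (Y t0)| + 1) => t /phase_le_bound; exact: ler_normlW.
have Slb y : has_lbound (S y).
  exists (- (`|c| + `|Num.max y (Y t0)| + 1)) => t /phase_le_bound.
  by rewrite ler_norml => /andP[].
have SS y y' : y <= y' -> S y `<=` S y'.
  move=> yy' t /= /le_trans; apply; rewrite ge_max !le_max yy' lexx orbT//.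
exists (fun y => sup (S y)), (fun y => inf (S y)); split.
- move=> y y' yy'; apply: ge_sup; first by exists t0.
  by move=> t /(SS _ _ yy') St; exact: ub_le_sup.
- move=> y y' yy'; apply: lb_le_inf; first by exists t0.
  by move=> t /(SS _ _ yy') St; exact: ge_inf.
- move=> t; have St : S (Y t) t by rewrite /S/= le_max lexx.
  case: (ltgtP t (sup (S (Y t)))) => [tsup||]; [right|by move=> /(le_lt_trans (ub_le_sup (Sub _) St)); rewrite ltxx|by left].
  case: (ltgtP (inf (S (Y t))) t) => [inft||//]; last first.
    by move=> /(lt_le_trans)/(_ (ge_inf (Slb _) St)); rewrite ltxx.
  have [z Sz tz] := sup_gt (ex_intro _ t0 (S0 _)) tsup.
  have [x Sx xt] := inf_lt (ex_intro _ t0 (S0 _)) inft.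
  have := phase_quasiconvex xt tz.
  move: Sx Sz; rewrite /S/= !(max_idPl (Yt0 t)) => Sx Sz.
  by rewrite lt_max !ltNge Sx Sz.
Qed.

End branches.

(** * Uniqueness on two parallel oblique lines *)

Section uniqueness_on_two_lines.
Variable R : realType.

Local Notation lambda := (@lebesgue_measure R).
Local Notation gamma := (@exp_sq_curve R).

Lemma ae_notin_countable (E : set R) : countable E -> {ae lambda, forall t, ~ E t}.
Proof.
move=> cE; exists E; split.
- exact: countable_measurable.
- exact: countable_lebesgue_measure0.
- by move=> t /= /contrapT.
Qed.

(** Label [t] by the floors of the two arguments. If [t] and [t'] share both labels, then [t - t']
    equals the increment of [tau1] and also that of [tau2] between [Y t'] and [Y t]; these have
    opposite signs, so [t = t']. *)
Lemma countable_branch_resonance (b : R) (Y tau1 tau2 : R -> R) : b != 0 ->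
  nondecreasing_fun tau1 -> nonincreasing_fun tau2 ->
  countable [set t | cos (b * t - b * tau1 (Y t)) = 1 /\
                     cos (b * t - b * tau2 (Y t)) = 1].
Proof.
move=> b0 tau1_nd tau2_ni; apply/countable_injP.
exists (fun t => pickle (Num.floor (b * t - b * tau1 (Y t)),
                         Num.floor (b * t - b * tau2 (Y t)))).
move=> t t' /[!inE] -[ct1 ct2] [ct1' ct2'] /(pcan_inj pickleK)[].
move=> /(cos_eq1_floor_inj ct1 ct1') + /(cos_eq1_floor_inj ct2 ct2').
rewrite -!mulrBr => /(mulfI b0) e1 /(mulfI b0) e2.
case: (leP (Y t) (Y t')) => [le|/ltW le].
- by have := tau1_nd _ _ le; have := tau2_ni _ _ le; lra.
- by have := tau1_nd _ _ le; have := tau2_ni _ _ le; lra.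
Qed.

Lemma two_parallel_lines_HUP (a1 a2 c : R) : a1 != a2 ->
  heisenberg_uniqueness_pair gamma (line (a1, 0) (c, 1) `|` line (a2, 0) (c, 1)).
Proof.
move=> a12 mu Xmu mu0 A mA; have [f1 [f2 [d1 d2]]] := X_curve_density Xmu.
pose w j (t : R) := pi * phase (j, 0) t.
have mphase v : measurable_fun [set: measurableTypeR R] (phase v) by exact: measurable_phase.
have mw j : measurable_fun [set: measurableTypeR R] (w j) by exact: measurable_funM.
pose F1 := rot_re (w a1) f1 f2; pose F2 := rot_im (w a1) f1 f2.
(* The phases of the two base points differ by [b t], so the second line rotates [F1 + i F2] by
   [wb]. *)
pose b := pi * (a2 - a1).
have b0 : b != 0 by rewrite mulf_neq0 ?(lt0r_neq0 (pi_gt0 R))// subr_eq0 eq_sym.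
pose wb (t : R) := b * t.
have mwb : measurable_fun [set: measurableTypeR R] wb by exact: measurable_funM.
have wE t : w a2 t = w a1 t + wb t by rewrite /w /wb /b /phase/=; ring.
have ann1 h : bounded_measurable h -> _ :=
  line_annihilated d1 d2 (fun xi Lxi => mu0 xi (or_introl Lxi)) (h := h).
have ann2 h : bounded_measurable h -> _ :=
  line_annihilated d1 d2 (fun xi Lxi => mu0 xi (or_intror Lxi)) (h := h).
have intF1 := integrable_rot_re d1.1 d2.1 (mw a1).
have intF2 := integrable_rot_im d1.1 d2.1 (mw a1).
have reE t : rot_re (w a2) f1 f2 t = rot_re wb F1 F2 t.
  by rewrite /rot_re /F1 /F2 /rot_im /rot_re wE cosD sinD; ring.
have imE t : rot_im (w a2) f1 f2 t = rot_im wb F1 F2 t.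
  by rewrite /rot_im /F1 /F2 /rot_im /rot_re wE cosD sinD; ring.
have [tau1 [tau2 [tau1_nd tau2_ni branch]]] := phase_branches c.
have mtau1 : measurable_fun setT (tau1 : R -> measurableTypeR R).
  exact: nondecreasing_measurable.
have mtau2 : measurable_fun setT (tau2 : R -> measurableTypeR R).
  exact: nonincreasing_measurable.
have hre h : bounded_measurable h ->
    \int[lambda]_t (h (phase (c, 1) t) * rot_re wb F1 F2 t) = 0.
  by move=> /ann2[<- _]; apply: eq_Rintegral => t _; rewrite -reE.
have him h : bounded_measurable h ->
    \int[lambda]_t (h (phase (c, 1) t) * rot_im wb F1 F2 t) = 0.
  by move=> /ann2[_ <-]; apply: eq_Rintegral => t _; rewrite -imE.
have br1 := branch_annihilated intF1 intF2 (mphase _) mwb mtau1 mtau2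
  (fun h bh => (ann1 h bh).1) (fun h bh => (ann1 h bh).2) hre him branch.
(* With the branches exchanged, a point where the density does not vanish satisfies both resonance
   conditions, hence lies in a countable set. *)
have br2 := branch_annihilated intF1 intF2 (mphase _) mwb mtau2 mtau1
  (fun h bh => (ann1 h bh).1) (fun h bh => (ann1 h bh).2) hre him
  (fun t => match branch t with or_introl e => or_intror e | or_intror e => or_introl e end).
have res := ae_notin_countable
  (countable_branch_resonance (phase (c, 1)) b0 tau1_nd tau2_ni).
have F0 : {ae lambda, forall t, F1 t = 0 /\ F2 t = 0}.
  apply: (@filterS3 _ _ (ae_filter_ringOfSetsType lambda) _ _ _ _ _ br1 br2 res).
  by move=> t [//|h1] [//|h2] h; case: h; split.
apply: (cmeasure_eq0 (w := w a1) d1 d2) => //.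
- by apply: (@filterS _ _ (ae_filter_ringOfSetsType lambda) _ _ _ F0) => t [].
- by apply: (@filterS _ _ (ae_filter_ringOfSetsType lambda) _ _ _ F0) => t [].
Qed.

End uniqueness_on_two_lines.

(** * Failure of uniqueness on one oblique line *)

Section non_uniqueness.
Variables (R : realType) (a c : R).

Local Notation lambda := (@lebesgue_measure R).
Local Notation gamma := (@exp_sq_curve R).
Local Notation Y := (phase (c, 1)).
Local Notation dY := (fun t : R => c + 2 * t * expR (t ^+ 2)).

(** Intermediate value theorem for [Y (t + 1) - Y (t - 1)], which is [2c] plus an odd function of
    [t] that is at least [4t] for [t >= 0]; hence the signs at [|c|] and [- |c|]. *)
Lemma phase_level : exists2 m : R, m - 1 < m + 1 & Y (m - 1) = Y (m + 1).
Proof.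
(* The difference is [e^((x - 1)^2) (e^(4x) - 1)], with first factor at least 1 and second at least
   [4x]. *)
have sg (x : R) : 0 <= x -> 4 * x <= expR ((x + 1) ^+ 2) - expR ((x - 1) ^+ 2).
  move=> x0; have -> : (x + 1) ^+ 2 = (x - 1) ^+ 2 + 4 * x by ring.
  rewrite expRD; have e1 : 1 + 4 * x <= expR (4 * x) by exact: expR_ge1Dx.
  have e2 : 1 + (x - 1) ^+ 2 <= expR ((x - 1) ^+ 2) by exact: expR_ge1Dx.
  by have := sqr_ge0 (x - 1); nra.
pose D t := Y (t + 1) - Y (t - 1).
have DE t : D t = 2 * c + (expR ((t + 1) ^+ 2) - expR ((t - 1) ^+ 2)).
  by rewrite /D !phase1E; ring.
have [m _ Dm] : exists2 m, m \in `[- `|c|, `|c|]%R & D m = 0.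
  apply: IVT; first by rewrite ge0_cp.
  - have cYD (e : R) : continuous (fun t => Y (t + e)).
      move=> t; apply: (@continuous_comp _ _ _ (fun t => t + e) Y).
        by apply: cvgD; [exact: cvg_id|exact: cvg_cst].
      exact: continuous_phase.
    by apply: continuous_subspaceT => t; apply: cvgB; exact: cYD.
  - have := sg _ (normr_ge0 c); have := ler_norm c; have := ler_norm (- c).
    rewrite normrN => h1 h2 h3; rewrite ge_min le_max !DE.
    have -> : (- `|c| + 1) ^+ 2 = (`|c| - 1) ^+ 2 by ring.
    have -> : (- `|c| - 1) ^+ 2 = (`|c| + 1) ^+ 2 by ring.
    by apply/andP; split; apply/orP; [left|right]; lra.
exists m; first by lra.
by apply/eqP; rewrite eq_sym -subr_eq0 -/(D m) Dm.
Qed.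

Lemma continuous_dphase : continuous dY.
Proof.
move=> t; apply: cvgD; first exact: cvg_cst.
apply: cvgM; last exact: continuous_exp_sq.
by apply: cvgM; [exact: cvg_cst|exact: cvg_id].
Qed.

(** The integrand is the derivative of [G] composed with [Y], where [G] is a primitive of
    [cos (s y + w)], and [Y] agrees at the two endpoints. *)
Lemma integral_cos_phase (m s w : R) : Y (m - 1) = Y (m + 1) ->
  \int[lambda]_(t in `[m - 1, m + 1]) (cos (s * Y t + w) * dY t) = 0.
Proof.
move=> Ym.
(* At [s = 0] the integrand of [G] is constant and its primitive is linear. *)
pose G y := if s == 0 then cos w * y else sin (s * y + w) / s.
have dG (y : R) : is_derive y 1 G (cos (s * y + w)).
  rewrite /G; case: eqVneq => [->|s0].
    by apply: is_derive_eq; rewrite /GRing.scale/= mul0r add0r; ring.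
  by apply: is_derive_eq; rewrite /GRing.scale/=; field.
have dGY (t : R) : is_derive t 1 (G \o Y) (cos (s * Y t + w) * dY t).
  have D1 := is_derive_phase c t; have D2 := dG (Y t).
  by apply: is_derive_eq; rewrite /GRing.scale/= mulrC.
have cGY : continuous (G \o Y).
  by move=> t; apply/differentiable_continuous/derivable1_diffP; case: (dGY t).
rewrite /Rintegral (@continuous_FTC2 _ _ (G \o Y)).
- by rewrite /comp Ym subee.
- by lra.
- apply: continuous_subspaceT => t; apply: cvgM; last exact: continuous_dphase.
  apply: (@continuous_comp _ _ _ (fun t => s * Y t + w) cos); last exact: continuous_cos.
  apply: cvgD; last exact: cvg_cst.
  by apply: cvgM; [exact: cvg_cst|exact: continuous_phase].
- split; first by move=> t _; case: (dGY t).
  + exact/cvg_at_right_filter/cGY.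
  + exact/cvg_at_left_filter/cGY.
- by move=> t _; rewrite derive1E; case: (dGY t).
Qed.

Lemma oblique_line_not_HUP :
  ~ heisenberg_uniqueness_pair gamma (line (a, 0) (c, 1)).
Proof.
move=> HUP; have [m m1 Ym] := phase_level.
pose J := `[m - 1, m + 1]%classic : set R.
pose w (t : R) := pi * phase (a, 0) t.
pose u (t : R) := (\1_J t : R) * dY t.
have mI : measurable (J : set (measurableTypeR R)) by exact: measurable_itv.
have mw : measurable_fun [set: measurableTypeR R] w.
  by apply: measurable_funM => //; exact: measurable_phase.
have uE : u = dY \_ J.
  by apply/funext => t; rewrite /u patchE indicE; case: ifP => _; rewrite ?mul1r ?mul0r.
have intu : lambda.-integrable setT (EFin \o u).
  rewrite uE -restrict_EFin; apply/integrable_restrict => //=; rewrite setTI.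
  apply: continuous_compact_integrable; first exact: segment_compact.
  by apply: continuous_subspaceT; exact: continuous_dphase.
(* The factor [e^(i w)] cancels the phase that the base point [(a, 0)] contributes to the
   transform. *)
pose f1 t := cos (w t) * u t; pose f2 t := sin (w t) * u t.
have int1 : lambda.-integrable setT (EFin \o f1).
  exact: (integrable_bounded_measurableM intu (bounded_measurable_cos mw)).
have int2 : lambda.-integrable setT (EFin \o f2).
  exact: (integrable_bounded_measurableM intu (bounded_measurable_sin mw)).
have [nu1 d1] := curve_density_charge int1; have [nu2 d2] := curve_density_charge int2.
pose mu := ComplexMeasure nu1 nu2.
have Xmu : X gamma mu by exact: (curve_density_X (mu := mu) d1 d2).
have cosu s v : \int[lambda]_t (cos (s * Y t + v) * u t) = 0.
  rewrite -(integral_cos_phase s v Ym) [RHS]Rintegral_mkcond.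
  apply: eq_Rintegral => t _; rewrite /u patchE indicE /J.
  by case: ifP => _; rewrite ?mul1r ?mul0r ?mulr0.
have mu0 xi : line (a, 0) (c, 1) xi -> fourier mu xi = 0.
  move=> [s ->]; rewrite (fourier_curve_density (mu := mu) _ d1 d2)/=.
  have th t : pi * (t * (a + s * c) + expR (t ^+ 2) * (0 + s * 1)) = (pi * s) * Y t + w t.
    by rewrite /w /phase/=; ring.
  have mth : measurable_fun [set: measurableTypeR R] (fun t => pi * s * Y t + w t).
    by apply: measurable_funD => //; apply: measurable_funM => //; exact: measurable_phase.
  have bcos := bounded_measurable_cos mth; have bsin := bounded_measurable_sin mth.
  under eq_Rintegral do rewrite th.
  under [X in _ + X]eq_Rintegral do rewrite th.
  under [X in Complex _ (X - _)]eq_Rintegral do rewrite th.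
  under [X in Complex _ (_ - X)]eq_Rintegral do rewrite th.
  congr Complex.
  - rewrite -RintegralD//; try exact: integrable_bounded_measurableM.
    rewrite -[RHS](cosu (pi * s) 0); apply: eq_Rintegral => t _.
    have -> : pi * s * Y t + 0 = (pi * s * Y t + w t) - w t by ring.
    by rewrite cosB /f1 /f2; ring.
  - rewrite -RintegralB//; try exact: integrable_bounded_measurableM.
    (* The shift by [pi / 2] turns the cosine into minus the sine. *)
    rewrite -[RHS](cosu (pi * s) (pi / 2)); apply: eq_Rintegral => t _.
    have -> : pi * s * Y t + pi / 2 = ((pi * s * Y t + w t) - w t) + pi / 2 by ring.
    by rewrite cosDpihalf sinB /f1 /f2; ring.
have ann f (nu : {charge set (plane R) -> \bar R}) : curve_density nu f ->
    (forall A : set (plane R), measurable A -> nu A = 0%E) ->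
    {ae lambda, forall t, f t = 0}.
  move=> [intf df] nu0.
  have : ae_eq lambda setT (EFin \o f) (cst 0%E).
    apply: integral_ae_eq => // E _ mE; rewrite integral0.
    have mfE : measurable ((@fst R R) @^-1` E : set (plane R)).
      by rewrite -[X in measurable X]setTI; exact: measurable_fst.
    exact: etrans (esym (df _ mfE)) (nu0 _ mfE).
  by apply: (@filterS _ _ (ae_filter_ringOfSetsType lambda)) => t /(_ I)[].
have cm0 A (mA : measurable (A : set (plane R))) := HUP mu Xmu mu0 A mA.
have nu10 (A : set (plane R)) : measurable A -> nu1 A = 0%E.
  by move=> mA; have [/eqP + _] := cm0 A mA; rewrite fine_eq0 ?fin_num_measure// => /eqP.
have nu20 (A : set (plane R)) : measurable A -> nu2 A = 0%E.
  by move=> mA; have [_ /eqP] := cm0 A mA; rewrite fine_eq0 ?fin_num_measure// => /eqP.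
(* If the measure vanished, [u] would be 0 almost everywhere. On [J] it equals [dY], which is
   strictly increasing and has at most one zero, so [J] would be null, although its length is 2. *)
have cE : countable [set t | dY t = 0].
  apply/countable_injP; exists (fun=> 0%N) => x y /[!inE]/= x0 y0 _.
  by case: (ltgtP x y) => // /(phase_derive_lt c); rewrite x0 y0 ltxx.
have [N [mN N0 IN]] : {ae lambda, forall t, ~ J t}.
  apply: (@filterS3 _ _ (ae_filter_ringOfSetsType lambda) _ _ _ _ _
    (ann _ _ d1 nu10) (ann _ _ d2 nu20) (ae_notin_countable cE)) => t f10 f20 dY0 It.
  apply: dY0 => /=; have <- : u t = dY t by rewrite /u indicE mem_set// mul1r.
  have -> : u t = (cos (w t) ^+ 2 + sin (w t) ^+ 2) * u t by rewrite cos2Dsin2 mul1r.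
  have -> : (cos (w t) ^+ 2 + sin (w t) ^+ 2) * u t = cos (w t) * f1 t + sin (w t) * f2 t.
    by rewrite /f1 /f2; ring.
  by rewrite f10 f20 !mulr0 addr0.
have : (lambda J <= 0)%E.
  by rewrite -N0; apply: le_measure; rewrite ?inE// => t It; apply: IN => /(_ It).
rewrite lebesgue_measure_itv/= lte_fin m1 -EFinB lee_fin; lra.
Qed.

End non_uniqueness.

(** * Normal form of lines and conclusion *)

(** Slide the base point to the intersection with the x-axis and divide the direction by [v.2]. *)
Lemma line_normal_form (R : realType) (p v : R * R) : v.2 != 0 ->
  line p v = line (p.1 - p.2 / v.2 * v.1, 0) (v.1 / v.2, 1).
Proof.
move=> v2; apply/seteqP; split => q [s ->] /=.
- by exists (p.2 + s * v.2); congr pair => /=; field.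
- by exists ((s - p.2) / v.2); congr pair => /=; field.
Qed.

Lemma horizontal_line_parallel (R : realType) (p v : R * R) :
  v <> (0, 0) -> v.2 = 0 -> parallel (line p v) (@x_axis R).
Proof.
move=> v0 v2; exists p, (0, 0), v; split => //.
have v1 : v.1 != 0.
  by apply/eqP => v1; apply: v0; rewrite [v]surjective_pairing v1 v2.
apply/seteqP; split => [q q2|q [s ->]]; last by rewrite /x_axis/= v2 mulr0 addr0.
exists (q.1 / v.1); rewrite /= !add0r v2 mulr0 mulfVK// -q2.
exact: surjective_pairing.
Qed.

Theorem theorem2p3 (R : realType) :
  (forall L : set (R * R), straight_line L ->
     (heisenberg_uniqueness_pair (@exp_sq_curve R) L <->
      parallel L (@x_axis R))) /\
  (forall L1 L2 : set (R * R),
     straight_line L1 -> straight_line L2 -> L1 <> L2 -> parallel L1 L2 ->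
     ~ parallel L1 (@x_axis R) -> ~ parallel L1 (@y_axis R) ->
     ~ parallel L2 (@x_axis R) -> ~ parallel L2 (@y_axis R) ->
     heisenberg_uniqueness_pair (@exp_sq_curve R) (L1 `|` L2)).
Proof.
split=> [L [p [v [v0 ->]]]|L1 L2 _ _ L12 [p [q [v [v0 L1E L2E]]]] nL1x _ _ _].
- split=> [HUP|[p' [q' [v' [v'0 -> xE]]]]].
    apply: horizontal_line_parallel => //; apply/eqP/negPn/negP => v2.
    by move: HUP; rewrite line_normal_form//; exact: oblique_line_not_HUP.
  have on_axis s : q'.2 + s * v'.2 = 0.
    have : line q' v' (q'.1 + s * v'.1, q'.2 + s * v'.2) by exists s.
    by rewrite -xE.
  have v'2 : v'.2 = 0 by have := on_axis 0; have := on_axis 1; lra.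
  apply: horizontal_line_HUP => //; apply/eqP => v'1.
  by apply: v'0; rewrite [v']surjective_pairing v'1 v'2.
- have v2 : v.2 != 0.
    apply/eqP => v2; apply: nL1x; rewrite L1E; exact: horizontal_line_parallel.
  rewrite L1E L2E !(line_normal_form _ v2); apply: two_parallel_lines_HUP.
  apply/eqP => e; apply: L12.
  by rewrite L1E L2E !(line_normal_form _ v2) e.
Qed.
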